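(* There is an isomorphism of $\mathbb F$-algebras between $\mathbb{NB}_n$ and $\mathbb{NB}_n^{diag}$ induced by sending $\mathbb U_0$ to the diagram consisting of $n$ vertical lines with a mark on the leftmost one, and $\mathbb U_i$ ($1\le i\le n-1$) to the unmarked diagram in which the top points $i,i+1$ are joined by an arc, the bottom points $i,i+1$ are joined by an arc, and all other points are joined by vertical lines. In particular, $\mathbb{NB}_n$ has the same dimension as the blob algebra $\mathbb B_n$, i.e. $\dim_{\mathbb F}(\mathbb{NB}_n)=\binom{2n}{n}$.
   Context: $\mathbb F$ is a field with $\mathrm{char}\,\mathbb F\ne2$; $n\ge1$; algebras are associative and unital. The nil-blob algebra $\mathbb{NB}_n$ is the $\mathbb F$-algebra with generators $\mathbb U_0,\ldots,\mathbb U_{n-1}$ and relations $\mathbb U_i^2=-2\mathbb U_i$ for $1\le i<n$; $\mathbb U_i\mathbb U_j\mathbb U_i=\mathbb U_i$ for $|i-j|=1$, $i,j>0$; $\mathbb U_i\mathbb U_j=\mathbb U_j\mathbb U_i$ for $|i-j|>1$; $\mathbb U_1\mathbb U_0\mathbb U_1=0$; $\mathbb U_0^2=0$. A Temperley-Lieb diagram on $n$ points is a planar crossingless matching (up to isotopy) of $n$ top and $n$ bottom points of a rectangle. A blob diagram is such a diagram in which each arc exposed to the left side of the rectangle (i.e. joinable to the left side by a path not meeting other arcs) may carry at most one mark; other arcs carry none. $\mathbb{NB}_n^{diag}$ has the blob diagrams as $\mathbb F$-basis; the product $D_1D_2$ is concatenation with $D_1$ on top of $D_2$, where each internal unmarked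 loop is removed and replaced by a factor $-2$, and a diagram containing a marked loop, or an arc with more than one mark, is zero. The blob algebra $\mathbb B_n=\mathbb B_n(m)$ (for $q\in\mathbb F^\times$, $[k]=q^{k-1}+q^{k-3}+\cdots+q^{-k+1}$, and $m\in\mathbb Z$ with $[m]\neq0$) is the algebra with generators $\mathbb V_0,\ldots,\mathbb V_{n-1}$ and relations $\mathbb V_i^2=-[2]\mathbb V_i$ ($1\le i<n$), $\mathbb V_i\mathbb V_j\mathbb V_i=\mathbb V_i$ ($|i-j|=1$, $i,j>0$), $\mathbb V_i\mathbb V_j=\mathbb V_j\mathbb V_i$ ($|i-j|>1$), $\mathbb V_1\mathbb V_0\mathbb V_1=[m-1]\mathbb V_1$, $\mathbb V_0^2=-[m]\mathbb V_0$. *)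

(* Defs.v *)
From HB Require Import structures.
From mathcomp Require Import all_boot all_order all_algebra.
From mathcomp Require Import boolp.
From mathcomp Require Import finmap monalg.
From mathcomp Require Import zify.

Set Implicit Arguments.
Unset Strict Implicit.
Unset Printing Implicit Defensive.

Import Order.TTheory GRing.Theory Num.Theory.
Local Open Scope ring_scope.
Local Open Scope quotient_scope.

Notation free_alg F n := {malg F[{fmonom (ordinal n)}]}.

Definition free_gen (F : fieldType) (n : nat) (i : 'I_n) : free_alg F n :=
  << fmu i >>.

Inductive gen_ideal (A : nzRingType) (rel : A -> A -> Prop) : A -> Prop :=
| gen_ideal_rel x y : rel x y -> gen_ideal rel (x - y)
| gen_ideal0 : gen_ideal rel 0
| gen_idealD x y : gen_ideal rel x -> gen_ideal rel y -> gen_ideal rel (x + y)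
| gen_idealMl a x : gen_ideal rel x -> gen_ideal rel (a * x)
| gen_idealMr a x : gen_ideal rel x -> gen_ideal rel (x * a).

Definition gen_ideal_pred (A : nzRingType) (rel : A -> A -> Prop) :=
  fun x : A => `[< gen_ideal rel x >].

Lemma gen_ideal_zmod_closed (A : nzRingType) (rel : A -> A -> Prop) :
  zmod_closed (gen_ideal_pred rel).
Proof.
split=> [|x y /asboolP Ix /asboolP Iy]; apply/asboolP; first exact: gen_ideal0.
by apply: gen_idealD => //; rewrite -mulN1r; apply: gen_idealMl.
Qed.

HB.instance Definition _ (A : nzRingType) (rel : A -> A -> Prop) :=
  GRing.isZmodClosed.Build A (gen_ideal_pred rel) (gen_ideal_zmod_closed rel).

Definition gen_ideal_zmod (A : nzRingType) (rel : A -> A -> Prop) : zmodClosed A :=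
  GRing.ZmodClosed.clone _ (gen_ideal_pred rel) _.

(* The quotient of the free algebra by the two-sided ideal generated by the
   x - y with rel x y.  For an arbitrary rel it may be the zero ring, so it only
   gets a pzRingType and an lmodType structure here. *)
Definition presented_alg (F : fieldType) (n : nat)
    (rel : free_alg F n -> free_alg F n -> Prop) :=
  Quotient.quot (gen_ideal_zmod rel).

Section PresentedAlg.
Variables (F : fieldType) (n : nat) (rel : free_alg F n -> free_alg F n -> Prop).
Local Notation Q := (presented_alg rel).

HB.instance Definition _ := GRing.Zmodule.on Q.
HB.instance Definition _ := EqQuotient.on Q.

Definition pres_pi (x : free_alg F n) : Q := \pi_Q x.

Lemma pres_piE (x y : free_alg F n) : pres_pi x = pres_pi y <-> gen_ideal rel (x - y).
Proof.
split=> [/eqP|Ixy]; first by rewrite -Quotient.idealrBE => /asboolP.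
by apply/eqP; rewrite -Quotient.idealrBE; apply/asboolP.
Qed.

Lemma pres_piD : {morph pres_pi : x y / x + y}.
Proof. exact: Quotient.pi_add. Qed.

Lemma pres_reprK : cancel (fun x : Q => repr x) pres_pi.
Proof. exact: reprK. Qed.

Lemma pres_repr x : gen_ideal rel (repr (pres_pi x) - x).
Proof. by apply/pres_piE; rewrite pres_reprK. Qed.

Definition pres_mul (x y : Q) : Q := pres_pi (repr x * repr y).
Definition pres_scale (c : F) (x : Q) : Q := pres_pi (c *: (repr x : free_alg F n)).

Lemma pres_piM x y : pres_mul (pres_pi x) (pres_pi y) = pres_pi (x * y).
Proof.
apply/pres_piE; set x' := repr _; set y' := repr _.
have -> : x' * y' - x * y = (x' - x) * y' + x * (y' - y).
  by rewrite mulrBl mulrBr addrA subrK.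
by apply: gen_idealD; [apply: gen_idealMr | apply: gen_idealMl];
  apply: pres_repr.
Qed.

Lemma pres_piZ c x : pres_scale c (pres_pi x) = pres_pi (c *: x).
Proof.
apply/pres_piE; rewrite -scalerBr -[_ - _]mul1r scalerAl.
by apply: gen_idealMl; apply: pres_repr.
Qed.

Lemma pres_mulA : associative pres_mul.
Proof.
move=> x y z; rewrite -(pres_reprK x) -(pres_reprK y) -(pres_reprK z).
by rewrite !pres_piM mulrA.
Qed.
Lemma pres_mul1 : left_id (pres_pi 1) pres_mul.
Proof. by move=> x; rewrite -(pres_reprK x) pres_piM mul1r. Qed.
Lemma pres_mulr1 : right_id (pres_pi 1) pres_mul.
Proof. by move=> x; rewrite -(pres_reprK x) pres_piM mulr1. Qed.
Lemma pres_mulDl : left_distributive pres_mul +%R.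
Proof.
move=> x y z; rewrite -(pres_reprK x) -(pres_reprK y) -(pres_reprK z).
by rewrite -pres_piD !pres_piM -pres_piD mulrDl.
Qed.
Lemma pres_mulDr : right_distributive pres_mul +%R.
Proof.
move=> x y z; rewrite -(pres_reprK x) -(pres_reprK y) -(pres_reprK z).
by rewrite -pres_piD !pres_piM -pres_piD mulrDr.
Qed.

HB.instance Definition _ := GRing.Zmodule_isPzRing.Build Q
  pres_mulA pres_mul1 pres_mulr1 pres_mulDl pres_mulDr.

Lemma pres_scaleA a b x : pres_scale a (pres_scale b x) = pres_scale (a * b) x.
Proof. by rewrite -(pres_reprK x) !pres_piZ scalerA. Qed.
Lemma pres_scale1 : left_id 1 pres_scale.
Proof. by move=> x; rewrite -(pres_reprK x) pres_piZ scale1r. Qed.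
Lemma pres_scaleDr : right_distributive pres_scale +%R.
Proof.
move=> c x y; rewrite -(pres_reprK x) -(pres_reprK y).
by rewrite -pres_piD !pres_piZ -pres_piD scalerDr.
Qed.
Lemma pres_scaleDl x : {morph pres_scale^~ x : a b / a + b}.
Proof. by move=> a b; rewrite -(pres_reprK x) !pres_piZ -pres_piD scalerDl. Qed.

HB.instance Definition _ := GRing.Zmodule_isLmodule.Build F Q
  pres_scaleA pres_scale1 pres_scaleDr pres_scaleDl.

Lemma pres_scaleAl (c : F) (x y : Q) : c *: (x * y) = c *: x * y.
Proof.
rewrite -(pres_reprK x) -(pres_reprK y) /GRing.mul /GRing.scale /=.
by rewrite !(pres_piZ, pres_piM) scalerAl.
Qed.

Lemma free_scaleAr (c : F) (x y : free_alg F n) : c *: (x * y) = x * (c *: y).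
Proof.
apply/malgP=> k; rewrite [LHS]mcoeffZ [X in _ * X = _]mcoeffMl.
rewrite [RHS](mcoeffMlw k (fsubset_refl (msupp x)) (msuppZ_le c y)) mulr_sumr.
apply: eq_bigr => i _; rewrite mulr_sumr; apply: eq_bigr => j _.
by rewrite mcoeffZ mulrnAr mulrCA.
Qed.

Lemma pres_scaleAr (c : F) (x y : Q) : c *: (x * y) = x * (c *: y).
Proof.
rewrite -(pres_reprK x) -(pres_reprK y) /GRing.mul /GRing.scale /=.
by rewrite !(pres_piZ, pres_piM) free_scaleAr.
Qed.

Lemma pres_neq0 :
  (forall x y, rel x y -> x@_(fmone _) = y@_(fmone _)) -> (1 : Q) != 0.
Proof.
move=> rel0; have pi0 : pres_pi 0 = 0.
  by apply: (addrI (pres_pi 0)); rewrite -pres_piD !addr0.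
apply/eqP; rewrite -pi0 => /(pres_piE 1 0); rewrite subr0.
suff I0 z : gen_ideal rel z -> z@_(fmone _) = 0.
  by move/I0/eqP; rewrite mcoeff1 eqxx oner_eq0.
elim=> [x y /rel0||x y _ IHx _ IHy|a x _ IH|a x _ IH].
- by rewrite mcoeffB => ->; rewrite subrr.
- exact: mcoeff0.
- by rewrite mcoeffD IHx IHy addr0.
- by rewrite [LHS](mcoeff1g_is_multiplicative _ F).1 /= IH mulr0.
- by rewrite [LHS](mcoeff1g_is_multiplicative _ F).1 /= IH mul0r.
Qed.
End PresentedAlg.

Section Relations.
Variables (F : fieldType) (n : nat).
Local Notation U := (@free_gen F n).

Inductive nil_blob_rel : free_alg F n -> free_alg F n -> Prop :=
| nil_blob_sq (i : 'I_n) : (0 < i)%N -> nil_blob_rel (U i * U i) ((- 2%:R) *: U i)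
| nil_blob_TL (i j : 'I_n) : (0 < i)%N -> (0 < j)%N -> `|i%:Z - j%:Z|%N = 1%N ->
    nil_blob_rel (U i * U j * U i) (U i)
| nil_blob_comm (i j : 'I_n) : (1 < `|i%:Z - j%:Z|)%N ->
    nil_blob_rel (U i * U j) (U j * U i)
| nil_blob_101 (i j : 'I_n) : i = 1%N :> nat -> j = 0%N :> nat ->
    nil_blob_rel (U i * U j * U i) 0
| nil_blob_sq0 (i : 'I_n) : i = 0%N :> nat -> nil_blob_rel (U i * U i) 0.

(* The quantum integer [k]; for k <= 0 it is fixed by [0] = 0 and [- k] = - [k],
   that is (q^k - q^-k) / (q - q^-1) whenever q^2 != 1. *)
Definition qint (q : F) (k : int) : F :=
  (sgz k)%:~R * \sum_(i < `|k|) q ^ (`|k|%:Z - 1 - 2 * i%:Z).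

Inductive blob_rel (q : F) (m : int) : free_alg F n -> free_alg F n -> Prop :=
| blob_sq (i : 'I_n) : (0 < i)%N -> blob_rel q m (U i * U i) ((- qint q 2) *: U i)
| blob_TL (i j : 'I_n) : (0 < i)%N -> (0 < j)%N -> `|i%:Z - j%:Z|%N = 1%N ->
    blob_rel q m (U i * U j * U i) (U i)
| blob_comm (i j : 'I_n) : (1 < `|i%:Z - j%:Z|)%N ->
    blob_rel q m (U i * U j) (U j * U i)
| blob_101 (i j : 'I_n) : i = 1%N :> nat -> j = 0%N :> nat ->
    blob_rel q m (U i * U j * U i) (qint q (m - 1) *: U i)
| blob_sq0 (i : 'I_n) : i = 0%N :> nat ->
    blob_rel q m (U i * U i) ((- qint q m) *: U i).
End Relations.

Definition nil_blob_alg (F : fieldType) (n : nat) :=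
  presented_alg (@nil_blob_rel F n).
Definition blob_alg (F : fieldType) (n : nat) (q : F) (m : int) :=
  presented_alg (@blob_rel F n q m).
Definition nil_blob_gen (F : fieldType) (n : nat) (i : 'I_n) : nil_blob_alg F n :=
  pres_pi _ (free_gen F i).

Lemma free_gen0 (F : fieldType) (n : nat) (i : 'I_n) :
  (free_gen F i)@_(fmone _) = 0.
Proof. by rewrite mcoeffU1; case: eqP => // /(congr1 (@fmonom_val _)); rewrite fmuE fmoneE. Qed.

Lemma free_genM0 (F : fieldType) (n : nat) (x : free_alg F n) (i : 'I_n) :
  (x * free_gen F i)@_(fmone _) = 0.
Proof.
by rewrite [LHS](mcoeff1g_is_multiplicative _ F).1 /= free_gen0 mulr0.
Qed.

Lemma nil_blob_neq0 (F : fieldType) (n : nat) : (1 : nil_blob_alg F n) != 0.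
Proof.
apply: pres_neq0 => x y [].
- by move=> i _; rewrite free_genM0 mcoeffZ free_gen0 mulr0.
- by move=> i j _ _ _; rewrite free_genM0 free_gen0.
- by move=> i j _; apply: etrans (free_genM0 _ _) (esym (free_genM0 _ _)).
- by move=> i j _ _; rewrite free_genM0 mcoeff0.
- by move=> i _; rewrite free_genM0 mcoeff0.
Qed.

Lemma blob_neq0 (F : fieldType) (n : nat) (q : F) (m : int) :
  (1 : blob_alg n q m) != 0.
Proof.
apply: pres_neq0 => x y [].
- by move=> i _; rewrite free_genM0 mcoeffZ free_gen0 mulr0.
- by move=> i j _ _ _; rewrite free_genM0 free_gen0.
- by move=> i j _; apply: etrans (free_genM0 _ _) (esym (free_genM0 _ _)).
- by move=> i j _ _; rewrite free_genM0 mcoeffZ free_gen0 mulr0.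
- by move=> i _; rewrite free_genM0 mcoeffZ free_gen0 mulr0.
Qed.

Section AlgInstances.
Variables (F : fieldType) (n : nat).

HB.instance Definition _ := GRing.PzRing.on (nil_blob_alg F n).
HB.instance Definition _ := GRing.Lmodule.on (nil_blob_alg F n).
HB.instance Definition _ :=
  GRing.PzSemiRing_isNonZero.Build (nil_blob_alg F n) (nil_blob_neq0 F n).
HB.instance Definition _ := GRing.Lmodule_isLalgebra.Build F (nil_blob_alg F n)
  (@pres_scaleAl F n (@nil_blob_rel F n)).
HB.instance Definition _ := GRing.Lalgebra_isAlgebra.Build F (nil_blob_alg F n)
  (@pres_scaleAr F n (@nil_blob_rel F n)).

Variables (q : F) (m : int).
HB.instance Definition _ := GRing.PzRing.on (blob_alg n q m).
HB.instance Definition _ := GRing.Lmodule.on (blob_alg n q m).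
HB.instance Definition _ :=
  GRing.PzSemiRing_isNonZero.Build (blob_alg n q m) (blob_neq0 n q m).
HB.instance Definition _ := GRing.Lmodule_isLalgebra.Build F (blob_alg n q m)
  (@pres_scaleAl F n (@blob_rel F n q m)).
HB.instance Definition _ := GRing.Lalgebra_isAlgebra.Build F (blob_alg n q m)
  (@pres_scaleAr F n (@blob_rel F n q m)).
End AlgInstances.

(* The endpoints of a diagram: [inl i] is the i-th top point and [inr i] the i-th
   bottom point, from the left, counting from 0. *)
Notation pt n := ('I_n + 'I_n)%type.

(* Rank of an endpoint when the boundary of the rectangle is walked from the left
   side: along the top to the right, then along the bottom back to the left. *)
Definition bpos (n : nat) (x : pt n) : nat :=
  match x with inl i => i | inr i => (n + n) - i.+1 end.

(* A crossingless matching, up to isotopy, as the map sending each endpoint to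
   the other end of its arc. *)
Definition is_TL (n : nat) (mu : {ffun pt n -> pt n}) : bool :=
  [forall x, (mu x != x) && (mu (mu x) == x)] &&
  [forall x, forall y,
    ~~ ((bpos x < bpos y < bpos (mu x)) && (bpos (mu x) < bpos (mu y)))%N].

(* The arc through x can be joined to the left side iff no arc separates it from
   there, i.e. iff it is not nested inside another arc for the order bpos. *)
Definition exposed (n : nat) (mu : {ffun pt n -> pt n}) (x : pt n) : bool :=
  [forall y, ~~ ((bpos y < minn (bpos x) (bpos (mu x))) &&
                 (maxn (bpos x) (bpos (mu x)) < bpos (mu y)))%N].

(* The marked arcs are recorded by the set of all their endpoints. *)
Definition is_blob (n : nat) (D : {ffun pt n -> pt n} * {set pt n}) : bool :=
  is_TL D.1 && [forall x in D.2, (D.1 x \in D.2) && exposed D.1 x].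

Definition blob (n : nat) := {D : {ffun pt n -> pt n} * {set pt n} | is_blob D}.
HB.instance Definition _ (n : nat) := Finite.on (blob n).

Definition link (n : nat) (D : blob n) : {ffun pt n -> pt n} := (val D).1.
Definition marked (n : nat) (D : blob n) : {set pt n} := (val D).2.

Definition line_fun (n : nat) : {ffun pt n -> pt n} :=
  [ffun x => match x with inl j => inr j | inr j => inl j end].

(* For 0 < i, the points i-1 and i are joined at the top and at the bottom. *)
Definition cup_fun (n : nat) (i : 'I_n) : {ffun pt n -> pt n} :=
  [ffun x => match x with
   | inl j => if j == i then inl (ord_pred i)
              else if j == ord_pred i then inl i else inr j
   | inr j => if j == i then inr (ord_pred i)
              else if j == ord_pred i then inr i else inl j
   end].

Lemma line_TL (n : nat) : is_TL (line_fun n).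
Proof.
apply/andP; split; apply/forallP => x.
  by rewrite !ffunE; case: x => x; rewrite /= eqxx.
apply/forallP => y; rewrite !ffunE.
by case: x y => x [] y /=; have := ltn_ord x; have := ltn_ord y; lia.
Qed.

Lemma ord_predE (n : nat) (i : 'I_n) : (0 < i)%N -> ord_pred i = i.-1 :> nat.
Proof.
move=> i0; have lt_in := ltn_ord i; rewrite /=.
have -> : ((i + n).-1 = i.-1 + n)%N by lia.
by rewrite modnDr modn_small //; lia.
Qed.

Lemma cup_TL (n : nat) (i : 'I_n) : (0 < i)%N -> is_TL (cup_fun i).
Proof.
move=> i0; have pE := ord_predE i0.
have cupE (x : pt n) : cup_fun i x = match x with
  | inl j => if j == i then inl (ord_pred i)
             else if j == ord_pred i then inl i else inr j
  | inr j => if j == i then inr (ord_pred i)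
             else if j == ord_pred i then inr i else inl j end.
  by rewrite ffunE.
move: (cup_fun i) (ord_pred i) pE cupE => mu p pE muE.
have pi : (p == i) = false by apply/eqP => /(congr1 (@nat_of_ord n)); lia.
apply/andP; split; apply/forallP => x.
  rewrite !muE; case: x => x; have [->|xi] := eqVneq x i;
    rewrite ?pi ?eqxx ?(inj_eq inl_inj) ?(inj_eq inr_inj) ?pi //;
  by have [->|xp] := eqVneq x p;
    rewrite ?eqxx ?(inj_eq inl_inj) ?(inj_eq inr_inj) ?(eq_sym i) ?pi
      ?(negbTE xi) ?(negbTE xp) ?eqxx.
apply/forallP => y; rewrite !muE.
have hi := ltn_ord i; have hp := ltn_ord p.
have eqN (a b : 'I_n) : (a == b) = (a == b :> nat) by [].
by case: x y => x [] y; have := ltn_ord x; have := ltn_ord y;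
  rewrite !eqN; do 4?[case: eqP => ?]; rewrite /=; lia.
Qed.

Lemma blob_unmarked (n : nat) (mu : {ffun pt n -> pt n}) :
  is_TL mu -> is_blob (mu, set0).
Proof. by move=> muTL; rewrite /is_blob muTL; apply/forall_inP => x; rewrite inE. Qed.

Lemma blob_line0 (n : nat) :
  is_blob (line_fun n, [set x : pt n | match x with inl j | inr j => j == 0%N :> nat end]).
Proof.
rewrite /is_blob line_TL; apply/forall_inP => x /=; rewrite !inE ffunE => x0.
apply/andP; split; first by case: x x0.
apply/forallP => y; rewrite !ffunE.
by case: x x0 y => x x0 [] y /=; have := ltn_ord x; have := ltn_ord y; lia.
Qed.

Definition line_diag (n : nat) : blob n := Sub _ (blob_unmarked (line_TL n)).
Definition marked_line_diag (n : nat) : blob n := Sub _ (blob_line0 n).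
Definition cup_diag (n : nat) (i : 'I_n) (i0 : (0 < i)%N) : blob n :=
  Sub _ (blob_unmarked (cup_TL i0)).

(* The concatenation of D1 on top of D2, as a graph: [inl x] and [inr x] are the
   endpoints of D1 and of D2; the edges are the arcs of D1, those of D2, and one
   edge between the i-th bottom point of D1 and the i-th top point of D2. *)
Section Concatenation.
Variables (n : nat) (D1 D2 : blob n).
Local Notation node := (pt n + pt n)%type.

Definition glue : rel node := fun u v =>
  match u, v with
  | inl x, inl y => link D1 x == y
  | inr x, inr y => link D2 x == y
  | inl (inr i), inr (inl j) => i == j
  | inr (inl i), inl (inr j) => i == j
  | _, _ => false
  end.

(* The endpoints of the concatenation. *)
Definition outer (x : pt n) : node :=
  match x with inl i => inl (inl i) | inr i => inr (inr i) end.

Definition is_loop : pred node := fun u => ~~ [exists x, connect glue u (outer x)].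

(* The number of marks on the component of u; each marked arc has two ends. *)
Definition nmarks (u : node) : nat :=
  #|[set v | connect glue u v &&
       match v with inl x => x \in marked D1 | inr x => x \in marked D2 end]|./2.

Definition concat_zero : bool :=
  [exists u, if is_loop u then (0 < nmarks u)%N else (1 < nmarks u)%N].

Definition nloops : nat := n_comp glue is_loop.

(* D is what is left of the concatenation once the loops are removed.  This
   determines D: its arcs join the endpoints lying on a common component, and an
   arc is marked iff its component carries a mark. *)
Definition is_concat (D : blob n) : bool :=
  [forall x, forall y,
     (link D x == y) == ((x != y) && connect glue (outer x) (outer y))] &&
  [forall x, (x \in marked D) == (0 < nmarks (outer x))%N].
End Concatenation.

Definition nil_blob_diag (F : fieldType) (n : nat) := {ffun blob n -> F^o}.
HB.instance Definition _ (F : fieldType) (n : nat) :=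
  GRing.Lmodule.on (nil_blob_diag F n).

(* {ffun _ -> _} only provides the vector space; the unit of the diagram algebra is
   diag_basis (line_diag n) and its product is diag_mul below, extended
   bilinearly from the product of two diagrams. *)
Section DiagramAlgebra.
Variables (F : fieldType) (n : nat).
Local Notation A := (nil_blob_diag F n).

Definition diag_basis (D : blob n) : A := [ffun D' => (D' == D)%:R].

Definition diag_prod (D1 D2 : blob n) : A :=
  if concat_zero D1 D2 then 0
  else \sum_(D | is_concat D1 D2 D) (- 2%:R) ^+ nloops D1 D2 *: diag_basis D.

Definition diag_mul (a b : A) : A :=
  \sum_(D1 : blob n) \sum_(D2 : blob n) (a D1 * b D2) *: diag_prod D1 D2.
End DiagramAlgebra.

Definition has_dim (F : fieldType) (V : lmodType F) (d : nat) : Prop :=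
  inhabited (Vector.axiom d V).

(* Main.v *)
Require Import Defs.
From HB Require Import structures.
From mathcomp Require Import all_boot all_order all_algebra perm.
From mathcomp Require Import finmap monalg zify.

Set Implicit Arguments.
Unset Strict Implicit.
Unset Printing Implicit Defensive.

Import Order.TTheory GRing.Theory Num.Theory.
Local Open Scope ring_scope.

(** Both algebras are instances of one presentation with three scalars: delta for
    an unmarked loop, gamma for a loop with one mark, beta for a second mark on an
    arc. The nil-blob algebra is the case (-2, 0, 0), the blob algebra the case
    (-[2], [m-1], -[m]).

    For any scalars the generators act on the span V of the blob diagrams: U_0
    marks the arc of the leftmost top point, and U_i joins the partners of the top
    points i and i+1 and puts a cup on these two points. [diag_act] is this action,
    and the lemmas [gen_sq], [gen_TL], [gen_comm], [gen_101], [gen_sq0] check the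
    relations. The isomorphism sends a to a.1, where 1 is the diagram of vertical
    lines. It is bijective because of three facts:

    - it is onto, since every blob diagram is obtained from the vertical lines by a
      reduced sequence of generators ([blob_gen_ind]);
    - the presented algebra is spanned by binomial(2n, n) normal words
      ([lspan_words], [size_nwords]);
    - there are at least binomial(2n, n) blob diagrams, because balanced walks of
      length 2n can be drawn as blob diagrams ([card_blob_ge]).

    So a space spanned by N vectors is mapped onto one of dimension at least N
    ([spanned_onto_bij]), and both dimensions are N.

    That a.1 depends multiplicatively on a in the nil case amounts to the identity
    (U_i D1) D2 = U_i (D1 D2) for the product of diagrams, which is defined by
    following paths in a glued graph. The action of U_i and the gluing are the same
    local move [join] on marked matchings: D1 D2 arises from the disjoint union of D1
    and D2 by joining, for each i in turn, the bottom point i of D1 with the top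
    point i of D2. [tracks_contract] shows by induction on the number of joined pairs
    that the matching and the scalar found in this way are those of the glued
    graph. Moves at disjoint places commute ([join_join], [join_weight_join]), so a
    move at the top of D1 can be done before or after the gluing
    ([concat_blob_act], [diag_mul_act]). That D1 D2 is planar need not be read off
    the graph: it follows by induction on a factorization of D1, since each single
    move preserves planarity ([planar_join], [planar_dot]). *)

(** * Marked perfect matchings and the local moves on them *)

(** Decides the equalities between points in the goal one after the other, innermost
    first, and discards the inconsistent cases at once. *)
Ltac cases_eq := repeat match goal with |- context [@eq_op _ ?a ?b] =>
  lazymatch a with context [@eq_op] => fail | _ =>
  lazymatch b with context [@eq_op] => fail | _ =>
    case: (@eqP _ a b) => ? //=; try congruence end end end.

(** The same, but first on the equalities that do not involve x: these fix the
    relative position of the given points before x is placed among them. *)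
Ltac cases_off x := repeat match goal with |- context [@eq_op _ ?a ?b] =>
  lazymatch a with context [@eq_op] => fail | x => fail | _ =>
  lazymatch b with context [@eq_op] => fail | x => fail | _ =>
    case: (@eqP _ a b) => ? //=; try congruence end end end.

Section MarkedMatching.
Variables (F : fieldType) (delta gamma beta : F) (T : finType).

(** The partner map and the set of ends of the marked arcs, on any finite set of
    points. Planarity is left out, so that the same moves serve for one diagram and
    for the union of two. *)
Definition matching := ({ffun T -> T} * {set T})%type.
Implicit Types (X : matching) (p q r s t x y : T).

Definition wf X : Prop :=
  [/\ forall x, X.1 (X.1 x) = x, forall x, X.1 x <> x
    & forall x, (X.1 x \in X.2) = (x \in X.2)].

(** Stacking a cup-cap on the points p and q: their partners become partners, the
    cup p-q is new and unmarked, and a mark on either old arc stays on the merged one. *)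
Definition join p q X : matching :=
  ([ffun x => if x == p then q else if x == q then p
              else if x == X.1 p then X.1 q else if x == X.1 q then X.1 p
              else X.1 x],
   [set x | [&& x != p, x != q
     & if (x == X.1 p) || (x == X.1 q) then (p \in X.2) || (q \in X.2)
       else x \in X.2]]).

(** When p and q are already partners a loop is split off; it costs gamma or delta
    according to its mark. Otherwise merging two marked arcs leaves one mark too many,
    which costs beta. *)
Definition join_weight p q X : F :=
  if X.1 p == q then (if p \in X.2 then gamma else delta)
  else if (p \in X.2) && (q \in X.2) then beta else 1.

Definition dot p X : matching := (X.1, [set x | [|| x == p, x == X.1 p | x \in X.2]]).

Definition dot_weight p X : F := if p \in X.2 then beta else 1.

Lemma link_inj X x y : wf X -> (X.1 x == X.1 y) = (x == y).
Proof. by case=> inv _ _; rewrite (inj_eq (can_inj inv)). Qed.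

Lemma link_swap X x y : wf X -> (X.1 x == y) = (x == X.1 y).
Proof. by move=> wfX; case: (wfX) => inv _ _; rewrite -(link_inj _ (X.1 y) wfX) inv. Qed.

Lemma joinE p q X x : (join p q X).1 x =
  if x == p then q else if x == q then p
  else if x == X.1 p then X.1 q else if x == X.1 q then X.1 p else X.1 x.
Proof. by rewrite ffunE. Qed.

Lemma join_mark p q X x : (x \in (join p q X).2) = [&& x != p, x != q
     & if (x == X.1 p) || (x == X.1 q) then (p \in X.2) || (q \in X.2)
       else x \in X.2].
Proof. by rewrite inE. Qed.

Lemma dot_mark p X x : (x \in (dot p X).2) = [|| x == p, x == X.1 p | x \in X.2].
Proof. by rewrite inE. Qed.

Lemma join_wf p q X : p != q -> wf X -> wf (join p q X).
Proof.
move=> /eqP pq [inv nfix mk]; have ip := inv p; have iq := inv q.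
have np := nfix p; have nq := nfix q.
split=> x.
- by have ix := inv x; have nx := nfix x; rewrite !joinE; cases_eq.
- by have ix := inv x; have nx := nfix x; rewrite !joinE; cases_eq.
- have ix := inv x; have nx := nfix x; have mx := mk x; have mp := mk p; have mq := mk q.
  rewrite !join_mark !joinE. 
  cases_eq.
Qed.

Lemma dot_wf p X : wf X -> wf (dot p X).
Proof.
move=> wfX; case: (wfX) => inv nfix mk; split=> // x.
rewrite !dot_mark /= mk (link_swap _ _ wfX) (link_inj _ _ wfX).
by case: eqP => //=; case: eqP.
Qed.

Lemma join_sym p q X : wf X -> p != q -> join p q X = join q p X.
Proof.
case=> inv nfix mk /eqP pq; have ip := inv p; have iq := inv q.
congr pair.
  by apply/ffunP => x; rewrite !ffunE; cases_eq.
apply/setP => x; rewrite !inE [(x == X.1 q) || _]orbC [(q \in _) || _]orbC.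
by cases_eq.
Qed.

Lemma join_weight_sym p q X : wf X -> join_weight p q X = join_weight q p X.
Proof.
move=> wfX; case: (wfX) => inv nfix mk; rewrite /join_weight (link_swap _ _ wfX) eq_sym andbC.
by case: eqP => // <-; rewrite mk.
Qed.

(** Both orders trace the same paths. As there is no structure beyond the partners
    of the four points, the proof compares the two results case by case. *)
Lemma join_join p q r s X : wf X -> uniq [:: p; q; r; s] ->
  join p q (join r s X) = join r s (join p q X).
Proof.
case=> inv nfix mk; rewrite /= !inE !negb_or.
case/and4P => /and3P[/eqP pq /eqP pr /eqP ps] /andP[/eqP qr /eqP qs] /eqP rs _.
have := (inv p, inv q, inv r, inv s, nfix p, nfix q, nfix r, nfix s).
move=> [[[[[[[ip iq] ir] iss] np] nq] nr] ns].
congr pair.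
  apply/ffunP => x; rewrite !ffunE; have ix := inv x; have nx := nfix x.
  cases_off x; cases_eq; try congruence.
apply/setP => x; have ix := inv x; have nx := nfix x.
have := (mk p, mk q, mk r, mk s) => -[[[mp mq] mr] ms].
rewrite !(inE, joinE).
cases_off x; cases_eq; try congruence;
  case Ep: (p \in X.2); case Eq: (q \in X.2); case Er: (r \in X.2);
  case Es: (s \in X.2); rewrite //=; congruence.
Qed.

(** The loops and the double marks met on the way may occur in a different order,
    but the same ones occur in total. *)
Lemma join_weight_join p q r s X : wf X -> uniq [:: p; q; r; s] ->
  join_weight r s X * join_weight p q (join r s X) = join_weight p q X * join_weight r s (join p q X).
Proof.
case=> inv nfix mk; rewrite /= !inE !negb_or.
case/and4P => /and3P[/eqP pq /eqP pr /eqP ps] /andP[/eqP qr /eqP qs] /eqP rs _.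
have := (inv p, inv q, inv r, inv s, nfix p, nfix q, nfix r, nfix s).
move=> [[[[[[[ip iq] ir] iss] np] nq] nr] ns].
have := (mk p, mk q, mk r, mk s) => -[[[mp mq] mr] ms].
rewrite /join_weight !join_mark !joinE.
cases_eq; case Ep: (p \in X.2); case Eq: (q \in X.2); case Er: (r \in X.2);
  case Es: (s \in X.2); rewrite /= ?mulr1 ?mul1r //; first [congruence | exact: mulrC].
Qed.

Lemma join_dot t p q X : wf X -> t != p -> t != q -> p != q ->
  dot t (join p q X) = join p q (dot t X).
Proof.
case=> inv nfix mk /eqP tp /eqP tq /eqP pq.
have [[ip iq] it] := (inv p, inv q, inv t).
have [[np nq] nt] := (nfix p, nfix q, nfix t).
have [[mp mq] mt] := (mk p, mk q, mk t).
congr pair; apply/setP => x; have ix := inv x; have nx := nfix x; have mx := mk x.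
rewrite !(inE, joinE).
by cases_eq; rewrite /= ?orbT.
Qed.

Lemma join_weight_dot t p q X : wf X -> t != p -> t != q -> p != q ->
  join_weight p q X * dot_weight t (join p q X) = dot_weight t X * join_weight p q (dot t X).
Proof.
case=> inv nfix mk /eqP tp /eqP tq /eqP pq.
have [[ip iq] it] := (inv p, inv q, inv t).
have [[np nq] nt] := (nfix p, nfix q, nfix t).
have [[mp mq] mt] := (mk p, mk q, mk t).
rewrite /join_weight /dot_weight !dot_mark !join_mark.
by cases_eq; case Ep: (p \in X.2); case Eq: (q \in X.2); case Et: (t \in X.2);
  rewrite /= ?mulr1 ?mul1r //; first [congruence | exact: mulrC].
Qed.

Lemma join_cup p q X : wf X -> X.1 p = q -> p \notin X.2 -> join p q X = X.
Proof.
case: X => mu S [/= inv nfix mk] pq pS; have ip := inv p; have mp := mk p.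
congr pair.
  apply/ffunP => x; rewrite !ffunE; have ix := inv x; by cases_eq.
apply/setP => x; rewrite !inE; have ix := inv x; have mx := mk x.
have := negbTE pS; by cases_eq.
Qed.

Definition relabel p r X : matching :=
  ([ffun x => tperm p r (X.1 (tperm p r x))], [set x | tperm p r x \in X.2]).

Lemma relabelK p r : involutive (relabel p r).
Proof.
move=> [mu S]; congr pair; first by apply/ffunP => x; rewrite !ffunE !tpermK.
by apply/setP => x; rewrite !inE tpermK.
Qed.

(** An unmarked cup p-q is a straightened strand: joining q with r drags the end r
    of an arc to p, whatever the arc is. *)
Lemma slide p q r X : wf X -> X.1 p = q -> p \notin X.2 -> r != p -> r != q ->
  join q r X = relabel p r X.
Proof.
case=> inv nfix mk pq /negbTE pX /eqP rp /eqP rq.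
have [[ip iq] ir] := (inv p, inv q, inv r).
have [[np nq] nr] := (nfix p, nfix q, nfix r).
have [[mp mq] mr] := (mk p, mk q, mk r).
congr pair.
  apply/ffunP => x; rewrite !ffunE; have ix := inv x; have nx := nfix x.
  by case: (tpermP p r x) => [?|?|??]; case: tpermP => [?|?|??]; cases_eq; congruence.
apply/setP => x; have ix := inv x; have nx := nfix x; have mx := mk x.
rewrite !inE; by case: (tpermP p r x) => [?|?|??]; cases_eq; case Eq: (q \in X.2); case Er: (r \in X.2);
  rewrite //=; congruence.
Qed.

Lemma slide_weight p q r X : wf X -> X.1 p = q -> p \notin X.2 -> r != p -> join_weight q r X = 1.
Proof.
move=> [inv nfix mk] pq pX /eqP rp; rewrite /join_weight -pq inv mk (negbTE pX).
by case: eqP => // /esym.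
Qed.

End MarkedMatching.
(** * Components of a graph, and sequential contraction *)

(** A set stable under a fixed-point-free involution splits into pairs. This gives
    both the parity of the number of marked ends on a component and the parity of the
    number of arcs that cross a vertical line. *)
Lemma even_invol (T : finType) (mu : T -> T) (A : {set T}) :
  (forall x, mu (mu x) = x) -> (forall x, mu x <> x) ->
  (forall x, x \in A -> mu x \in A) -> ~~ odd #|A|.
Proof.
move=> inv nfix; have [k] := ubnP #|A|; elim: k A => // k IH A; rewrite ltnS => Ak muA.
have [->|[x xA]] := set_0Vmem A; first by rewrite cards0.
have xmx : mu x != x by apply/eqP; exact: nfix.
have E : #|A| = #|A :\ x :\ mu x|.+2.
  by rewrite (cardsD1 x) xA (cardsD1 (mu x)) in_setD1 xmx muA.
rewrite E /= negbK; apply: IH; first by rewrite E in Ak; apply: leq_trans Ak.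
move=> y; rewrite !inE => /and3P[ymx yx yA]; rewrite muA // andbT.
rewrite (inj_eq (can_inj inv)) yx /=; apply: contra ymx => /eqP <-.
by rewrite inv.
Qed.

(** Cut a path at its first and at its last passage through the new edge: the pieces
    before and after use old edges only. *)
Lemma connect_add (T : finType) (e e' : rel T) p q : connect_sym e ->
  (forall x y, e' x y = [|| e x y, (x == p) && (y == q) | (x == q) && (y == p)]) ->
  forall x y, connect e' x y = [|| connect e x y, connect e x p && connect e q y
                                 | connect e x q && connect e p y].
Proof.
move=> sym e'E.
have sub x y : connect e x y -> connect e' x y.
  by apply: connect_sub => {}x {}y xy; apply: connect1; rewrite e'E xy.
have pq : connect e' p q by apply: connect1; rewrite e'E !eqxx orbT.
have qp : connect e' q p by apply: connect1; rewrite e'E !eqxx !orbT.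
move=> x y; apply/idP/idP; last first.
  case/or3P => [/sub //|/andP[/sub xp /sub qy]|/andP[/sub xq /sub py]].
    exact: connect_trans xp (connect_trans pq qy).
  exact: connect_trans xq (connect_trans qp py).
case/connectP => s; elim: s x => [|z s IH] x /=; first by move=> _ ->; rewrite connect0.
case/andP; rewrite e'E => xz zs ey; have {IH zs ey} := IH z zs ey.
case/or3P: xz => [/connect1 xz|/andP[/eqP -> /eqP ->]|/andP[/eqP -> /eqP ->]].
- case/or3P => [zy|/andP[zp qy]|/andP[zq py]].
  + by rewrite (connect_trans xz zy).
  + by rewrite (connect_trans xz zp) qy orbT.
  + by rewrite (connect_trans xz zq) py !orbT.
- case/or3P => [zy|/andP[zp qy]|/andP[zq py]].
  + by rewrite connect0 zy orbT.
  + by rewrite connect0 qy orbT.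
  + by rewrite py.
- case/or3P => [zy|/andP[zp qy]|/andP[zq py]].
  + by rewrite connect0 zy !orbT.
  + by rewrite qy.
  + by rewrite connect0 py !orbT.
Qed.

(** The components as sets of points: these stay literally equal when the relation
    grows elsewhere, which root representatives do not. *)
Definition classes_of (T : finType) (e : rel T) (a : pred T) : {set {set T}} :=
  [set [set y | connect e x y] | x in [pred x | a x]].

Lemma n_comp_classes (T : finType) (e : rel T) (a : pred T) : connect_sym e ->
  closed e a -> n_comp e a = #|classes_of e a|.
Proof.
move=> sym cla; rewrite /n_comp_mem.
rewrite -(card_in_imset (f := fun x => [set y | connect e x y])); last first.
  move=> x y; rewrite !inE => /andP[/eqP rx _] /andP[/eqP ry _] /setP/(_ y).
  by rewrite !inE connect0 => xy; rewrite -rx -ry; apply/(fingraph.rootP sym).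
apply: eq_card => C; apply/imsetP/imsetP => -[x].
  by rewrite inE => /andP[_ ax] ->; exists x.
rewrite inE => ax ->; exists (fingraph.root e x).
  rewrite !inE (roots_root sym) /=.
  by move: (closed_connect cla (connect_root e x)); rewrite /in_mem /= ax => <-.
by apply/setP => y; rewrite !inE (same_connect sym (connect_root e x)).
Qed.

Section Contraction.
Variables (F : fieldType) (delta gamma beta : F) (T : finType).
Implicit Types (X : matching T) (p q : T) (L : seq (T * T)).

Definition step p q (cX : F * matching T) : F * matching T :=
  (cX.1 * join_weight delta gamma beta p q cX.2, join p q cX.2).

Definition contract L (cX : F * matching T) : F * matching T :=
  foldl (fun cX pq => step pq.1 pq.2 cX) cX L.

Definition ends L : seq T := flatten [seq [:: pq.1; pq.2] | pq <- L].

Lemma ends_rcons L p q : ends (rcons L (p, q)) = ends L ++ [:: p; q].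
Proof. by rewrite /ends map_rcons flatten_rcons. Qed.

Lemma step_step p q r s (cX : F * matching T) : wf cX.2 -> uniq [:: p; q; r; s] ->
  step p q (step r s cX) = step r s (step p q cX).
Proof.
move=> wfX u; rewrite /step /= -!mulrA (join_weight_join _ _ _ wfX u).
by rewrite (join_join wfX u).
Qed.

(** A move at points away from the contracted pairs can be postponed until after
    the contraction. *)
Lemma contract_step p q L cX : uniq (p :: q :: ends L) -> wf cX.2 ->
  contract L (step p q cX) = step p q (contract L cX).
Proof.
elim: L cX => //= -[a b] L IH cX.
rewrite /= !inE !negb_or => u wfX.
repeat match goal with H : is_true (_ && _) |- _ => case/andP: H => ? ? end.
rewrite -step_step //; last by rewrite /= !inE !negb_or; repeat (apply/andP; split).
rewrite IH //=; last exact: join_wf.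
by rewrite inE negb_or; repeat (apply/andP; split).
Qed.
End Contraction.
(** * Sequential contraction computes the glued graph *)

Section Graph.
Variables (F : fieldType) (delta : F) (T : finType) (X0 : matching T).
Hypothesis wf0 : wf X0.
Implicit Types (X : matching T) (p q u v x y : T) (L : seq (T * T)).

Definition edges L : rel T :=
  fun x y => [|| X0.1 x == y, (x, y) \in L | (y, x) \in L].
Definition nmark L u : nat := #|[set v | connect (edges L) u v && (v \in X0.2)]|./2.
(** A component without free points, which in the end is a loop of the concatenation. *)
Definition closedc L : pred T :=
  fun u => ~~ [exists x, (x \notin ends L) && connect (edges L) u x].
(** In the nil case the scalar is zero as soon as a loop carries a mark, or an open
    strand carries two. *)
Definition killed L : bool :=
  [exists u, if closedc L u then (0 < nmark L u)%N else (1 < nmark L u)%N].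

Lemma edges_sym L : symmetric (edges L).
Proof.
by move=> x y; rewrite /edges (link_swap _ _ wf0) eq_sym [(_ \in L) || _]orbC.
Qed.

Lemma econn_sym L : connect_sym (edges L).
Proof. exact/sym_connect_sym/edges_sym. Qed.

(** Each marked arc contributes both of its ends to the component. *)
Lemma mark_ends_double L u :
  #|[set v | connect (edges L) u v && (v \in X0.2)]| = (nmark L u).*2.
Proof.
rewrite -[LHS]odd_double_half (negbTE (even_invol (mu := X0.1) _ _ _)) //; case: (wf0) => //.
move=> inv nfix mk x; rewrite !inE mk => /andP[ux ->]; rewrite andbT.
by apply: connect_trans ux (connect1 _); rewrite /edges eqxx.
Qed.

Lemma eq_nmark L u v : connect (edges L) u v -> nmark L u = nmark L v.
Proof.
move=> uv; rewrite /nmark; congr (_./2); apply: eq_card => x.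
by rewrite !inE (same_connect (@econn_sym L) uv).
Qed.

(** The invariant of the contraction: at the free points, partners in the current
    matching are the points on a common component of the graph, and marks are the marks
    of components; the scalar is the power of delta that counts the components closed up
    so far, unless the marks have made it zero. *)
Definition tracks L (cX : F * matching T) : Prop :=
  [/\ wf cX.2,
      {in [predC ends L] &, forall x y, connect (edges L) x y = (x == y) || (cX.2.1 x == y)},
      {in [predC ends L], forall x, cX.2.1 x \notin ends L},
      {in [predC ends L], forall x, (x \in cX.2.2) = (0 < nmark L x)%N}
    & cX.1 = if killed L then 0
             else delta ^+ #|classes_of (edges L) (closedc L)| ].

Lemma connect_edges0 x y : connect (edges [::]) x y = (x == y) || (X0.1 x == y).
Proof.
case: wf0 => inv nfix mk.
apply/idP/idP => [|/orP[/eqP->|/eqP<-]]; rewrite ?connect0 //; last first.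
  by apply: connect1; rewrite /edges eqxx.
case/connectP => s; elim: s x => [|z s IH] x /=; first by move=> _ ->; rewrite eqxx.
rewrite {1}/edges !in_nil !orbF => /andP[/eqP <- zs ey]; have := IH _ zs ey.
by rewrite inv orbC.
Qed.

Lemma nmark0 x : nmark [::] x = (x \in X0.2).
Proof.
case: (wf0) => inv nfix mk.
rewrite /nmark; have -> : [set v | connect (edges [::]) x v && (v \in X0.2)] =
   if x \in X0.2 then [set x; X0.1 x] else set0.
  apply/setP => v; rewrite inE connect_edges0 ![_ == v]eq_sym.
  case: ifP => xS; rewrite !inE.
    by case: eqP => [->|_] /=; [rewrite xS | case: eqP => [->|//]; rewrite mk xS].
  by case: eqP => [->|_] /=; [rewrite xS | case: eqP => [->|//]; rewrite mk xS].
case: ifP; last by rewrite cards0.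
by rewrite cards2 eq_sym; case: eqP => // /nfix.
Qed.

Lemma tracks0 : tracks [::] (1, X0).
Proof.
have cl u : closedc [::] u = false.
  by apply/negbTE; rewrite negbK; apply/existsP; exists u; rewrite connect0.
split=> //=.
- by move=> x y _ _; rewrite connect_edges0.
- by move=> x _; rewrite nmark0; case: (x \in _).
- have -> : killed [::] = false.
    by apply/negbTE/existsPn => u; rewrite cl nmark0; case: (u \in _).
  rewrite /classes_of (_ : [set _ | _ in _] = set0) ?cards0 //.
  by apply/setP => C; rewrite inE; apply/negP => /imsetP[u]; rewrite inE cl.
Qed.

Section Step.
Variables (L : seq (T * T)) (p q : T) (c : F) (X : matching T).
Hypothesis pqL : uniq (ends L ++ [:: p; q]).
Hypothesis trk : tracks L (c, X).
Local Notation L' := (rcons L (p, q)).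
Local Notation e := (edges L).

Let pL : p \notin ends L.
Proof. by move: pqL; rewrite cat_uniq /= => /and3P[_]; rewrite negb_or => /andP[]. Qed.
Let qL : q \notin ends L.
Proof. by move: pqL; rewrite cat_uniq /= => /and3P[_]; rewrite !negb_or => /and3P[]. Qed.
Let pq : p != q.
Proof. by move: pqL; rewrite cat_uniq /= inE => /and4P[]. Qed.

Let ends' x : (x \in ends L') = [|| x \in ends L, x == p | x == q].
Proof. by rewrite ends_rcons mem_cat !inE. Qed.

Let conn' x y : connect (edges L') x y =
  [|| connect e x y, connect e x p && connect e q y | connect e x q && connect e p y].
Proof.
apply: connect_add => [|{}x {}y]; first exact: econn_sym.
rewrite /edges !mem_rcons !inE -!pair_eqE /pair_eq /=.
by rewrite [(y == p) && _]andbC -!orbA; do !bool_congr.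
Qed.

Let far u : ~~ connect e u p -> ~~ connect e u q -> connect (edges L') u =1 connect e u.
Proof. by move=> up uq v; rewrite conn' (negbTE up) (negbTE uq) !orbF. Qed.

Let near u : connect e u p || connect e u q ->
  connect (edges L') u =1 (fun v => connect e p v || connect e q v).
Proof.
move=> upq v; rewrite conn'; case/orP: upq => u1.
  rewrite u1 (same_connect (@econn_sym L) u1) /=.
  by case: (connect e p v); case: (connect e q v); rewrite ?andbF ?orbT.
rewrite u1 (same_connect (@econn_sym L) u1) /=.
by case: (connect e p v); case: (connect e q v); rewrite ?andbF ?orbT.
Qed.

Let pq_conn : connect e p q = (X.1 p == q).
Proof. by case: trk => _ -> //; rewrite (negbTE pq). Qed.

Let nmark' u : nmark L' u =
  if (connect e u p || connect e u q) && (X.1 p != q)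
  then (nmark L p + nmark L q)%N else nmark L u.
Proof.
rewrite -pq_conn; case: ifP => [/andP[upq npq]|].
  rewrite /nmark (_ : [set _ | _] = [set v | connect e p v && (v \in X0.2)]
     :|: [set v | connect e q v && (v \in X0.2)]); last first.
    by apply/setP => v; rewrite !inE near // andb_orl.
  rewrite cardsU (_ : _ :&: _ = set0) ?cards0 ?subn0 ?mark_ends_double ?halfD ?odd_double ?doubleK //.
  apply/setP => v; rewrite !inE; apply: contraNF npq => /andP[/andP[pv _] /andP[qv _]].
  by rewrite (same_connect_r (@econn_sym L) qv).
move=> H; rewrite /nmark; congr (_./2); apply: eq_card => v; rewrite !inE.
congr (_ && _); case: (boolP (connect e u p || connect e u q)) H => [upq|].
  rewrite /= => /negbFE pq1; rewrite near //.
  have up : connect e u p.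
    by case/orP: upq => // uq; rewrite (same_connect_r (@econn_sym L) pq1).
  rewrite -(same_connect (@econn_sym L) pq1) orbb.
  by rewrite (same_connect (@econn_sym L) up).
by rewrite negb_or => /andP[up uq] _; rewrite far.
Qed.

Let closedc' u : closedc L' u =
  closedc L u || (connect e u p || connect e u q) && (X.1 p == q).
Proof.
case: trk => /= wfX connX outX _ _.
case: (boolP (connect e u p || connect e u q)) => [upq|].
  have -> : closedc L u = false.
    apply/negbTE; rewrite negbK; apply/existsP.
    by case/orP: upq => [up|uq]; [exists p; rewrite pL | exists q; rewrite qL].
  rewrite /=; case: eqP => [Xpq|/eqP Xpq].
    apply/existsPn => x; rewrite ends' !negb_or near //; apply/negP.
    case/andP => /and3P[xL /eqP xp /eqP xq].
    rewrite !connX // -Xpq; case: wfX => -> _ _.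
    by rewrite Xpq ![_ == x]eq_sym; case: eqP => //; case: eqP.
  apply/negbTE; rewrite negbK; apply/existsP; exists (X.1 p).
  rewrite near // ends' !negb_or outX //= Xpq connX // ?eqxx ?orbT //; last exact: outX.
  by case: wfX => _ /(_ p)/eqP -> _.
rewrite negb_or => /andP[up uq]; rewrite orbF; congr (~~ _); apply: eq_existsb => x.
rewrite far // ends' !negb_or; case: (boolP (connect e u x)) => // ux; last by rewrite !andbF.
rewrite !andbT; case: eqP => [xp|_]; first by rewrite -xp ux in up.
by case: eqP => [xq|_]; [rewrite -xq ux in uq | rewrite andbT].
Qed.

Let killed' : killed L' = killed L || (if X.1 p == q then p \in X.2 else (p \in X.2) && (q \in X.2)).
Proof.
case: trk => /= wfX connX outX mkX _.
have clF u : connect e u p || connect e u q -> closedc L u = false.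
  move=> upq; apply/negbTE; rewrite negbK; apply/existsP.
  by case/orP: upq => [up|uq]; [exists p; rewrite pL | exists q; rewrite qL].
rewrite !mkX //; apply/idP/idP.
  case/existsP => u; rewrite closedc' nmark'.
  case: (boolP (connect e u p || connect e u q)) => [upq|_] /=; last first.
    by rewrite orbF => Hu; apply/orP; left; apply/existsP; exists u.
  rewrite (clF _ upq) /=; case: eqP => [Xpq|Xpq] /=.
    move=> Hu; apply/orP; right; rewrite -(@eq_nmark L u) //.
    case/orP: upq => // uq; apply: connect_trans uq _.
    by rewrite econn_sym pq_conn Xpq.
  move=> Hu; case: (boolP (killed L)) => //= /existsPn nk.
  have := nk p; have := nk q; rewrite !clF ?connect0 ?orbT //.
  by case: (nmark L p) Hu => [|[|]] //; case: (nmark L q) => [|[|]].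
case/orP => [/existsP[u Hu]|Hpq]; apply/existsP.
  exists u; rewrite closedc' nmark'.
  case: (boolP (connect e u p || connect e u q)) => [upq|_] /=; last by rewrite orbF.
  move: Hu; rewrite (clF _ upq) /=; case: eqP => [Xpq|Xpq] /= Hu; first exact: ltnW.
  by case/orP: upq => /eq_nmark <-; [apply: ltn_addr | apply: ltn_addl].
exists p; rewrite closedc' nmark' connect0 /= clF ?connect0 //=.
case: eqP Hpq => // _ /andP[].
by case: (nmark L p) => // k; case: (nmark L q) => // l; rewrite addnS.
Qed.

Let classes' : #|classes_of (edges L') (closedc L')| =
  ((X.1 p == q) + #|classes_of e (closedc L)|)%N.
Proof.
case: trk => /= wfX connX outX mkX _.
have clF u : connect e u p || connect e u q -> closedc L u = false.
  move=> upq; apply/negbTE; rewrite negbK; apply/existsP.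
  by case/orP: upq => [up|uq]; [exists p; rewrite pL | exists q; rewrite qL].
case: eqP => [Xpq|Xpq].
  have cpq : connect e p q by rewrite pq_conn Xpq.
  have same u : connect (edges L') u =1 connect e u.
    move=> v; case: (boolP (connect e u p || connect e u q)) => [upq|].
      rewrite near // -(same_connect (@econn_sym L) cpq) orbb.
      have up : connect e u p.
        by case/orP: upq => // uq; rewrite (same_connect_r (@econn_sym L) cpq).
      by rewrite (same_connect (@econn_sym L) up).
    by rewrite negb_or => /andP[up uq]; rewrite far.
  have -> : classes_of (edges L') (closedc L') =
     [set y | connect e p y] |: classes_of e (closedc L).
    apply/setP => C; rewrite !inE; apply/imsetP/orP.
      case=> u; rewrite inE closedc' Xpq eqxx andbT => /orP[cu|upq] ->.
        right; apply/imsetP; exists u; first by rewrite inE.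
        by apply/setP => y; rewrite !inE same.
      left; apply/eqP/setP => y; rewrite !inE same.
      have up : connect e u p.
        by case/orP: upq => // uq; rewrite (same_connect_r (@econn_sym L) cpq).
      by rewrite (same_connect (@econn_sym L) up).
    case=> [/eqP ->|/imsetP[u]].
      exists p; first by rewrite inE closedc' connect0 Xpq eqxx orbT.
      by apply/setP => y; rewrite !inE same.
    rewrite inE => cu ->; exists u; first by rewrite inE closedc' cu.
    by apply/setP => y; rewrite !inE same.
  rewrite cardsU1; congr (_ + _)%N; apply/eqP; rewrite eqb1.
  apply/imsetP => -[u]; rewrite inE => cu /setP/(_ p); rewrite !inE connect0 => up.
  by move: cu; rewrite clF // -up.
rewrite add0n /classes_of; congr #|pred_of_set _|.
have sub u : closedc L u -> connect (edges L') u =1 connect e u.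
  move=> cu; apply: far; apply: contraTN cu => uu; apply/negbT; apply: clF; by rewrite uu ?orbT.
apply/setP => C; apply/imsetP/imsetP => -[u]; rewrite inE => cu ->; exists u.
- by move: cu; rewrite inE closedc' (introF eqP Xpq) andbF orbF.
- apply/setP => y; rewrite !inE sub //.
  by move: cu; rewrite closedc' (introF eqP Xpq) andbF orbF.
- by rewrite inE closedc' cu.
- by apply/setP => y; rewrite !inE sub.
Qed.

(** Joining p with q either closes up their common component, which then carries the
    new loop, or merges two open strands without touching any loop. *)
Lemma tracks_step : tracks L' (step delta 0 0 p q (c, X)).
Proof.
case: (trk) => /= wfX connX outX mkX cE.
have out' x : x \notin ends L' -> [/\ x \notin ends L, x <> p & x <> q].
  by rewrite ends' !negb_or => /and3P[-> /eqP ? /eqP].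
case: (wfX) => inv nfix mk; have ip := inv p; have iq := inv q.
split=> /=.
- exact: join_wf.
- move=> x y /out'[xL xp xq] /out'[yL yp yq].
  rewrite conn' !connX // joinE; have ix := inv x; have iy := inv y.
  by cases_eq.
- move=> x /out'[xL xp xq]; rewrite ends' joinE !negb_or; have ix := inv x.
  have := outX x xL; have := outX p pL; have := outX q qL.
  by cases_eq; do ?case: (_ \in _).
- move=> x /out'[xL xp xq]; rewrite join_mark nmark' !connX //.
  rewrite (introF eqP xp) (introF eqP xq) /= !mkX // -!(link_swap _ _ wfX).
  case: (X.1 p =P q) => [Xpq|_]; rewrite ?andbF ?andbT.
    have /negbTE -> : X.1 x != p by apply/eqP; congruence.
    by have /negbTE -> : X.1 x != q by apply/eqP; congruence.
  by case: ifP => //= _; rewrite addn_gt0.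
- rewrite cE /join_weight killed' classes'; case: (killed L); first by rewrite mul0r.
  case: eqP => _ /=; case: (p \in X.2) => /=; rewrite ?mulr0 ?mulr1 ?exprS //.
    by rewrite mulrC.
  by case: (q \in X.2); rewrite ?mulr0 ?mulr1.
Qed.
End Step.

Lemma tracks_contract L : uniq (ends L) -> tracks L (contract delta 0 0 L (1, X0)).
Proof.
elim/last_ind: L => [|L [p q] IH] u; first exact: tracks0.
rewrite /contract foldl_rcons -/(contract _ _ _ _ _) /=.
move: u; rewrite ends_rcons => u.
(* The pairs are processed from left to right, so the last one is the new step. *)
have uL : uniq (ends L) by move: u; rewrite cat_uniq => /and3P[].
by case: (contract _ _ _ _ _) (IH uL) => c X trk; apply: tracks_step.
Qed.
End Graph.
(** * Planar matchings are stable under the local moves *)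

Section Planar.
Variables (T : finType) (b : T -> nat).
Hypothesis b_inj : injective b.
Implicit Types (X : matching T) (p q x y : T).

(** Noncrossing and exposure of marked arcs, for the points read off in the linear
    order given by the injection b. *)
Record planar X : Prop := Planar {
  planar_wf : wf X;
  planar_nc : forall x y, ~ (b x < b y < b (X.1 x) /\ b (X.1 x) < b (X.1 y))%N;
  planar_exp : forall x, x \in X.2 -> forall y,
    ~ (b y < minn (b x) (b (X.1 x)) /\ maxn (b x) (b (X.1 x)) < b (X.1 y))%N }.

Lemma b_neq x y : x <> y -> b x <> b y.
Proof. by move=> xy /b_inj. Qed.

(** Noncrossing in symmetric form: an arc has both ends between x and its partner,
    or none. This is the form in which crossings are excluded below. *)
Lemma planar_sep X x y : planar X -> y <> x -> y <> X.1 x ->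
  (b x < b y < b (X.1 x) \/ b (X.1 x) < b y < b x)%N <->
  (b x < b (X.1 y) < b (X.1 x) \/ b (X.1 x) < b (X.1 y) < b x)%N.
Proof.
case=> -[inv nfix _] nc _ yx yXx.
have ix := inv x; have iy := inv y.
have := nc x y; have := nc x (X.1 y); have := nc (X.1 x) y; have := nc (X.1 x) (X.1 y).
have := nc y x; have := nc (X.1 y) x; have := nc y (X.1 x); have := nc (X.1 y) (X.1 x).
rewrite ix iy.
have /b_neq : X.1 y <> x by congruence.
have /b_neq : X.1 y <> X.1 x by congruence.
have /b_neq := yx; have /b_neq := yXx.
lia.
Qed.

(** As p and q are neighbours, no arc separates them, and the arcs p-a and q-b bound
    a common region; so the new arc a-b can be drawn in that region. If one of the two
    old arcs is exposed, the region reaches the left side and a-b is exposed. *)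
Lemma planar_join p q X : b q = (b p).+1 -> planar X -> planar (join p q X).
Proof.
move=> bpq plX; case: (plX) => wfX nc ex; case: (wfX) => inv nfix mk.
have pq : p <> q by move=> E; rewrite E in bpq; lia.
have ip := inv p; have iq := inv q; have np := nfix p; have nq := nfix q.
(* Any other arc has both ends or none between the ends of the new arc. *)
have gen z : z <> p -> z <> q -> z <> X.1 p -> z <> X.1 q -> X.1 p <> q ->
    (b (X.1 p) < b z < b (X.1 q) \/ b (X.1 q) < b z < b (X.1 p))%N <->
    (b (X.1 p) < b (X.1 z) < b (X.1 q) \/ b (X.1 q) < b (X.1 z) < b (X.1 p))%N.
  move=> zp zq zXp zXq Xpq; have iz := inv z.
  have := planar_sep plX zp zXp; have := planar_sep plX zq zXq.
  have /b_neq := zp; have /b_neq := zq.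
  have /b_neq : X.1 z <> p by congruence.
  have /b_neq : X.1 z <> q by congruence.
  have /b_neq : X.1 z <> X.1 p by congruence.
  have /b_neq : X.1 z <> X.1 q by congruence.
  have /b_neq := zXp; have /b_neq := zXq.
  have /b_neq : X.1 p <> p by [].
  have /b_neq : X.1 p <> q by [].
  have /b_neq : X.1 q <> p by congruence.
  have /b_neq : X.1 q <> q by [].
  lia.
split; first by apply: join_wf => //; apply/eqP.
  move=> x y; rewrite !joinE.
  have ix := inv x; have iy := inv y; have nx := nfix x; have ny := nfix y.
  case: (x =P p) => [->|xp]; first by lia.
  case: (x =P q) => [->|xq]; first by lia.
  case: (y =P p) => [->|yp]; first by lia.
  case: (y =P q) => [->|yq]; first by lia.
  case: (x =P X.1 p) => [xXp|xXp].
    have Xpq : X.1 p <> q by congruence.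
    case: (y =P X.1 p) => [->|yXp]; first by lia.
    case: (y =P X.1 q) => [->|yXq]; first by lia.
    by have := gen y yp yq yXp yXq Xpq; rewrite xXp; lia.
  case: (x =P X.1 q) => [xXq|xXq].
    have Xpq : X.1 p <> q by congruence.
    case: (y =P X.1 p) => [->|yXp]; first by lia.
    case: (y =P X.1 q) => [->|yXq]; first by lia.
    by have := gen y yp yq yXp yXq Xpq; rewrite xXq; lia.
  case: (y =P X.1 p) => [yXp|yXp].
    have Xpq : X.1 p <> q by congruence.
    by have := gen x xp xq xXp xXq Xpq; rewrite yXp; lia.
  case: (y =P X.1 q) => [yXq|yXq].
    have Xpq : X.1 p <> q by congruence.
    by have := gen x xp xq xXp xXq Xpq; rewrite yXq; lia.
  exact: nc.
move=> x; rewrite join_mark => /and3P[/eqP xp /eqP xq xS] y; rewrite !joinE.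
have ix := inv x; have iy := inv y; have nx := nfix x; have ny := nfix y.
rewrite (introF eqP xp) (introF eqP xq).
have xp' := b_neq xp; have xq' := b_neq xq.
case: (y =P p) => [->|yp].
  by case: eqP => _; [|case: eqP => _]; lia.
case: (y =P q) => [->|yq].
  by case: eqP => _; [|case: eqP => _]; lia.
(* An arc around the new arc also goes around p and q, which are neighbours, hence around both old arcs. *)
have new : (p \in X.2) || (q \in X.2) -> X.1 p <> q -> y <> X.1 p -> y <> X.1 q ->
    ~ (b y < minn (b (X.1 p)) (b (X.1 q)) /\
       maxn (b (X.1 p)) (b (X.1 q)) < b (X.1 y))%N.
  move=> pqS Xpq yXp yXq.
  have p_y : p <> y by congruence.
  have q_y : q <> y by congruence.
  have p_Xy : p <> X.1 y by congruence.
  have q_Xy : q <> X.1 y by congruence.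
  have := planar_sep plX p_y p_Xy; have := planar_sep plX q_y q_Xy.
  have := b_neq p_y; have := b_neq q_y; have := b_neq p_Xy; have := b_neq q_Xy.
  by case/orP: pqS => /ex/(_ y); lia.
case: (x =P X.1 p) xS => /= [xE pqS|xXp].
  have Xpq : X.1 p <> q by congruence.
  rewrite xE.
  case: (y =P X.1 p) => [->|yXp]; first by lia.
  case: (y =P X.1 q) => [->|yXq]; first by lia.
  exact: new.
case: (x =P X.1 q) => /= [xE pqS|xXq xS].
  have Xpq : X.1 p <> q by congruence.
  rewrite xE.
  case: (y =P X.1 p) => [->|yXp]; first by lia.
  case: (y =P X.1 q) => [->|yXq]; first by lia.
  by rewrite minnC maxnC; apply: new.
have exx := ex x xS.
have p_x : p <> x by congruence.
have q_x : q <> x by congruence.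
have p_Xx : p <> X.1 x by congruence.
have q_Xx : q <> X.1 x by congruence.
have sp := planar_sep plX p_x p_Xx; have sq := planar_sep plX q_x q_Xx.
have n1 := b_neq p_x; have n2 := b_neq q_x; have n3 := b_neq p_Xx; have n4 := b_neq q_Xx.
have ep := exx p; have eq := exx q.
have := exx (X.1 p); have := exx (X.1 q); rewrite ip iq => eXq eXp.
case: (y =P X.1 p) => [->|yXp]; first by lia.
case: (y =P X.1 q) => [->|yXq]; first by lia.
exact: exx.
Qed.

(** The arc of the very first point cannot be nested inside another one. *)
Lemma planar_dot p X : (forall x, b p <= b x)%N -> planar X -> planar (dot p X).
Proof.
move=> p0 plX; case: (plX) => wfX nc ex; case: (wfX) => inv nfix mk.
split=> // [|x]; first exact: dot_wf.
rewrite dot_mark => /or3P[/eqP->|/eqP->|/ex//] y; rewrite /= ?inv;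
  by have := p0 y; lia.
Qed.

End Planar.
(** * The generators acting on blob diagrams, and their relations *)

Lemma bpos_inj n : injective (@bpos n).
Proof.
move=> [] i [] j /=; have := ltn_ord i; have := ltn_ord j => Hi Hj E; try lia;
  by congr (_ _); apply: val_inj => /=; lia.
Qed.

Lemma is_blobP n (X : matching (pt n)) : reflect (planar (@bpos n) X) (is_blob X).
Proof.
apply: (iffP idP) => [/andP[/andP[/forallP inv /forallP nc]] /forall_inP ex|].
  have inv1 x : X.1 (X.1 x) = x by case/andP: (inv x) => _ /eqP.
  split.
  - split=> // x; first by case/andP: (inv x) => /eqP.
    apply/idP/idP => [/ex/andP[]|/ex/andP[]//]; by rewrite inv1.
  - by move=> x y []; have /forallP/(_ y) := nc x; case: (_ < _ < _)%N => //= /negbTE ->.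
  - move=> x /ex/andP[_ /forallP e] y []; have := e y.
    by case: (_ < minn _ _)%N => //= /negbTE ->.
case=> -[inv nfix mk] nc ex; apply/andP; split; first (apply/andP; split).
- by apply/forallP => x; rewrite inv eqxx andbT; apply/eqP/nfix.
- by apply/forallP => x; apply/forallP => y; apply/negP => /andP[? ?]; apply: (nc x y).
- apply/forall_inP => x xS; rewrite mk xS /=; apply/forallP => y.
  by apply/negP => /andP[? ?]; apply: (ex x xS y).
Qed.

Lemma blob_planar n (D : blob n) : planar (@bpos n) (val D).
Proof. exact/is_blobP/valP. Qed.

Lemma blob_wf n (D : blob n) : wf (val D).
Proof. exact: planar_wf (blob_planar D). Qed.

Section Generators.
Variables (F : fieldType) (delta gamma beta : F) (n : nat).
Implicit Types (i j : 'I_n) (X : matching (pt n)) (D : blob n).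

Definition gen i X : matching (pt n) :=
  if i == 0%N :> nat then dot (inl i) X else join (inl (ord_pred i)) (inl i) X.

Definition gen_weight i X : F :=
  if i == 0%N :> nat then dot_weight beta (inl i) X
  else join_weight delta gamma beta (inl (ord_pred i)) (inl i) X.

Lemma ord_pred_neq i : i != 0%N :> nat -> inl (ord_pred i) != inl i :> pt n.
Proof.
move=> i0; rewrite (inj_eq inl_inj) -val_eqE [val _]ord_predE ?lt0n //=.
by rewrite -lt0n in i0; lia.
Qed.

Lemma gen_wf i X : wf X -> wf (gen i X).
Proof.
rewrite /gen; case: ifPn => [_|i0]; [exact: dot_wf | exact/join_wf/ord_pred_neq].
Qed.

Lemma gen_blob i D : is_blob (gen i (val D)).
Proof.
apply/is_blobP; rewrite /gen; have [i0|i0] := eqVneq (nat_of_ord i) 0%N.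
  by apply: planar_dot (blob_planar D) => x /=; rewrite i0.
apply: planar_join (blob_planar D); first exact: bpos_inj.
by rewrite /bpos ord_predE ?lt0n // prednK ?lt0n.
Qed.

Definition blob_act i D : blob n := Sub (gen i (val D)) (gen_blob i D).

(** Sliding the end r along the cup to p and back again restores the matching; this
    is the relation U_i U_j U_i = U_i. *)
Lemma slide_back (T : finType) (p q r : T) Y : wf Y -> Y.1 p = q -> p \notin Y.2 -> r != p -> r != q ->
  [/\ join p q (join q r Y) = Y, join_weight delta gamma beta q r Y = 1
    & join_weight delta gamma beta p q (join q r Y) = 1].
Proof.
move=> wfY pq pY rp rq; have [inv nfix mk] := wfY.
have npq : p != q by rewrite eq_sym -pq; apply/eqP/nfix.
have wfZ : wf (join q r Y) by apply: join_wf => //; rewrite eq_sym.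
have E := slide wfY pq pY rp rq.
have Zr : (join q r Y).1 r = q by rewrite joinE (negbTE rq) eqxx.
have rZ : r \notin (join q r Y).2 by rewrite join_mark eqxx andbF.
have pr : p != r by rewrite eq_sym.
rewrite (slide_weight delta gamma beta wfY pq pY rp); split=> //.
  rewrite (join_sym wfZ npq) (slide wfZ Zr rZ pr npq) E.
  rewrite (_ : relabel r p = relabel p r) ?relabelK //.
  by rewrite /relabel tpermC.
by rewrite (join_weight_sym _ _ _ _ _ wfZ) (slide_weight delta gamma beta wfZ Zr rZ pr).
Qed.

(** After U_i has acted, the top points i and i+1 are joined by an unmarked cup;
    the relations that start with U_i only need this. *)
Lemma gen_cupped i X : i != 0%N :> nat -> wf X ->
  [/\ wf (gen i X), (gen i X).1 (inl (ord_pred i)) = inl i, (gen i X).1 (inl i) = inl (ord_pred i),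
      inl (ord_pred i) \notin (gen i X).2 & inl i \notin (gen i X).2].
Proof.
move=> i0 wfX; have := gen_wf i wfX; have := ord_pred_neq i0; rewrite /gen (negbTE i0).
move=> ii; rewrite !joinE !join_mark !eqxx [_ == inl (ord_pred i)]eq_sym (negbTE ii) andbF.
by split.
Qed.

Lemma gen_sq i X : i != 0%N :> nat -> wf X ->
  gen i (gen i X) = gen i X /\ gen_weight i (gen i X) = delta.
Proof.
move=> i0 wfX; have [w1 E1 _ m1 _] := gen_cupped i0 wfX.
rewrite {1}/gen /gen_weight (negbTE i0) (join_cup w1) //; split=> //.
by rewrite /join_weight E1 eqxx (negbTE m1).
Qed.

Lemma gen_TL i j X : i != 0%N :> nat -> j != 0%N :> nat ->
  i = j.+1 :> nat \/ j = i.+1 :> nat -> wf X ->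
  [/\ gen i (gen j (gen i X)) = gen i X, gen_weight j (gen i X) = 1
    & gen_weight i (gen j (gen i X)) = 1].
Proof.
move=> i0 j0 ij wfX; have [w1 E1 E2 m1 m2] := gen_cupped i0 wfX.
move: (gen i X) w1 E1 E2 m1 m2 => Y wfY E1 E2 m1 m2.
have ipE := ord_predE (n := n) (i := i); have jpE := ord_predE (n := n) (i := j).
rewrite !lt0n in ipE jpE; have {}ipE := ipE i0; have {}jpE := jpE j0.
rewrite /gen /gen_weight (negbTE i0) (negbTE j0).
have iip := ord_pred_neq i0; have jjp := ord_pred_neq j0.
have wfZ : wf (join (inl (ord_pred j)) (inl j) Y) by apply: join_wf.
case: ij => ij.
  have jE : ord_pred i = j by apply: val_inj => /=; rewrite [LHS]ipE; lia.
  rewrite jE in E1 E2 m1 iip *.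
  have jpi : inl (ord_pred j) != inl i :> pt n.
    by rewrite (inj_eq inl_inj) -val_eqE [val _]jpE /=; lia.
  have [A1 A2 A3] := slide_back wfY E2 m2 jpi jjp.
  rewrite (join_sym wfY jjp) (join_weight_sym _ _ _ _ _ wfY).
  have wfZ' : wf (join (inl j) (inl (ord_pred j)) Y) by apply: join_wf; rewrite // eq_sym.
  by rewrite (join_sym wfZ' iip) (join_weight_sym _ _ _ _ _ wfZ') A1 A2 A3.
have iE : ord_pred j = i by apply: val_inj => /=; rewrite [LHS]jpE; lia.
rewrite iE in jjp *.
have ipj : inl j != inl (ord_pred i) :> pt n.
  by rewrite (inj_eq inl_inj) -val_eqE [val (ord_pred _)]ipE /=; lia.
have jii : inl j != inl i :> pt n by rewrite eq_sym.
by have [A1 A2 A3] := slide_back wfY E1 m1 ipj jii; rewrite A1 A2 A3.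
Qed.

Lemma gen_101 i j X : i = 1%N :> nat -> j = 0%N :> nat -> wf X ->
  [/\ gen i (gen j (gen i X)) = gen i X, gen_weight j (gen i X) = 1
    & gen_weight i (gen j (gen i X)) = gamma].
Proof.
move=> i1 j0 wfX; have i0 : i != 0%N :> nat by rewrite i1.
have [w1 E1 E2 m1 m2] := gen_cupped i0 wfX.
move: (gen i X) w1 E1 E2 m1 m2 => Y wfY E1 E2 m1 m2; rewrite /gen /gen_weight i1 j0 /=.
have jE : ord_pred i = j by apply: val_inj; rewrite [LHS]ord_predE ?i1 ?j0.
rewrite jE in E1 E2 m1 *; rewrite /dot_weight (negbTE m1); split=> //.
  case: Y wfY E1 E2 m1 m2 => mu S [/= inv nfix mk] E1 E2 m1 m2; congr pair.
    by apply/ffunP => x; rewrite !ffunE /= E1 E2; do !case: eqP => [->//|_].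
  apply/setP => x; rewrite !inE /= E1 E2.
  by case: eqP => [->|_]; [rewrite (negbTE m1) | case: eqP => [->|//]; rewrite (negbTE m2)].
by rewrite /join_weight dot_mark eqxx /= E1 eqxx.
Qed.

Lemma gen_sq0 i X : i = 0%N :> nat -> wf X ->
  gen i (gen i X) = gen i X /\ gen_weight i (gen i X) = beta.
Proof.
move=> i0 wfX; rewrite /gen /gen_weight i0 eqxx /dot_weight dot_mark eqxx; split=> //.
by congr pair; apply/setP => x; rewrite !inE /=; do 2!case: (x == _).
Qed.

Lemma gen_comm i j X : (i.+1 < j)%N || (j.+1 < i)%N -> wf X ->
  gen i (gen j X) = gen j (gen i X) /\
  gen_weight j X * gen_weight i (gen j X) = gen_weight i X * gen_weight j (gen i X).
Proof.
wlog ij : i j / (i.+1 < j)%N => [H|_].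
  case/orP => ij wfX; first by apply: H; rewrite ?ij.
  by have [-> ->] : gen j (gen i X) = gen i (gen j X) /\
     gen_weight i X * gen_weight j (gen i X) = gen_weight j X * gen_weight i (gen j X) by apply: H; rewrite ?ij.
move=> wfX; have j0 : j != 0%N :> nat by lia.
have jpE : ord_pred j = j.-1 :> nat by rewrite ord_predE //; lia.
have ij' : inl i != inl j :> pt n by rewrite (inj_eq inl_inj) -val_eqE /=; lia.
have ijp : inl i != inl (ord_pred j) :> pt n.
  by rewrite (inj_eq inl_inj) -val_eqE [val (ord_pred _)]jpE /=; lia.
have jj := ord_pred_neq j0.
rewrite /gen /gen_weight (negbTE j0); case: ifPn => i0.
  by rewrite (join_weight_dot _ _ _ wfX) // (join_dot wfX).
have ii := ord_pred_neq i0.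
have ipE : ord_pred i = i.-1 :> nat by rewrite ord_predE //; lia.
have u : uniq [:: inl (ord_pred i); inl i; inl (ord_pred j); inl j : pt n].
  rewrite /= !inE !negb_or ii ij' ijp jj /= !(inj_eq inl_inj) -!val_eqE.
  by rewrite ![val (ord_pred _)]ipE ![val (ord_pred _)]jpE /=; lia.
by rewrite (join_weight_join _ _ _ wfX u) (join_join wfX u).
Qed.

End Generators.
(** * Concatenation as a sequence of contractions *)

Section Agree.
Variables (F : fieldType) (delta gamma beta : F) (T T' : finType).
Implicit Types (X : matching T) (Y : matching T') (phi : T -> T').

(** The matching X is a union of components of Y along phi. *)
Definition agrees phi X Y : Prop :=
  forall x, Y.1 (phi x) = phi (X.1 x) /\ (phi x \in Y.2) = (x \in X.2).

Lemma agrees_join phi X Y p q : injective phi -> agrees phi X Y ->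
  agrees phi (join p q X) (join (phi p) (phi q) Y) /\
  join_weight delta gamma beta (phi p) (phi q) Y = join_weight delta gamma beta p q X.
Proof.
move=> inj ag; have [p1 p2] := ag p; have [q1 q2] := ag q.
split=> [x|]; last by rewrite /join_weight p1 p2 q2 (inj_eq inj).
have [x1 x2] := ag x.
rewrite !joinE !join_mark p1 p2 q1 q2 x1 x2 !(inj_eq inj); split=> //.
by do ?case: ifP.
Qed.

Lemma agrees_dot phi X Y p : injective phi -> agrees phi X Y ->
  agrees phi (dot p X) (dot (phi p) Y) /\ dot_weight beta (phi p) Y = dot_weight beta p X.
Proof.
move=> inj ag; have [p1 p2] := ag p; split=> [x|]; last by rewrite /dot_weight p2.
by have [x1 x2] := ag x; rewrite !dot_mark p1 x2 !(inj_eq inj).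
Qed.

Lemma agrees_relabel phi X Y p r : agrees phi X Y ->
  agrees (fun x => tperm p r (phi x)) X (relabel p r Y).
Proof. by move=> ag x; have [x1 x2] := ag x; rewrite ffunE inE tpermK x1 x2. Qed.

Lemma eq_agrees phi psi X Y : phi =1 psi -> agrees phi X Y -> agrees psi X Y.
Proof. by move=> E ag x; rewrite -!E; apply: ag. Qed.

End Agree.

Section DisjointUnion.
Variables (F : fieldType) (delta gamma beta : F) (T1 T2 : finType).
Implicit Types (X : matching T1) (Y : matching T2).

Definition dunion X Y : matching (T1 + T2)%type :=
  ([ffun u => match u with inl x => inl (X.1 x) | inr y => inr (Y.1 y) end],
   [set u | match u with inl x => x \in X.2 | inr y => y \in Y.2 end]).

Lemma dunion_wf X Y : wf X -> wf Y -> wf (dunion X Y).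
Proof.
case=> i1 n1 m1 [i2 n2 m2]; split=> -[] x; rewrite ?ffunE ?inE /= ?ffunE ?i1 ?i2 ?m1 ?m2 //.
  by case=> /n1. by case=> /n2.
Qed.

Lemma agrees_dunionr X Y : agrees inr Y (dunion X Y).
Proof. by move=> y; rewrite ffunE inE. Qed.

Lemma dunion_join p q X Y :
  dunion (join p q X) Y = join (inl p) (inl q) (dunion X Y) /\
  join_weight delta gamma beta p q X = join_weight delta gamma beta (inl p) (inl q) (dunion X Y).
Proof.
split; last by rewrite /join_weight ffunE !inE (inj_eq inl_inj).
congr pair; first by apply/ffunP => -[] x; rewrite !ffunE //= !(inj_eq inl_inj); do ?case: ifP.
by apply/setP => -[] x; rewrite !(inE, ffunE) //= !(inj_eq inl_inj).
Qed.

Lemma dunion_dot p X Y :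
  dunion (dot p X) Y = dot (inl p) (dunion X Y) /\
  dot_weight beta p X = dot_weight beta (inl p) (dunion X Y).
Proof.
split; last by rewrite /dot_weight !inE.
by congr pair; apply/setP => -[] x; rewrite !(inE, ffunE) //= !(inj_eq inl_inj).
Qed.
End DisjointUnion.

Section ContractionScalars.
Variables (F : fieldType) (delta gamma beta : F) (T : finType).
Implicit Types (X : matching T) (L : seq (T * T)).
Local Notation contract := (contract delta gamma beta).

Lemma contract_scale L c X :
  contract L (c, X) = (c * (contract L (1, X)).1, (contract L (1, X)).2).
Proof.
elim: L c X => [|[p q] L IH] c X /=; first by rewrite mulr1.
by rewrite /step /= IH [in RHS]IH mul1r mulrA.
Qed.

Lemma contract_dot t L c X : uniq (t :: ends L) -> wf X ->
  contract L (c * dot_weight beta t X, dot t X) =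
  let cX := contract L (c, X) in (cX.1 * dot_weight beta t cX.2, dot t cX.2).
Proof.
elim: L c X => //= -[p q] L IH c X.
rewrite /= !inE !negb_or => u wfX.
repeat match goal with H : is_true (_ && _) |- _ => case/andP: H => ? ? end.
rewrite {1}/step /= -(join_dot wfX) // -mulrA -(join_weight_dot _ _ _ wfX) // mulrA.
rewrite IH //=; last exact: join_wf.
exact/andP.
Qed.
End ContractionScalars.

Section Concat.
Variables (F : fieldType) (delta : F) (n : nat).
Implicit Types (i : 'I_n) (D : blob n).
Local Notation node := (pt n + pt n)%type.

(** The pairs of points that are identified when D1 is put on top of D2. *)
Definition seam : seq (node * node) := [seq (inl (inr i), inr (inl i)) | i <- enum 'I_n].

Definition concat D1 D2 (c : F) D : Prop :=
  let cY := contract delta 0 0 seam (1, dunion (val D1) (val D2)) in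
  cY.1 = c /\ agrees (@outer n) (val D) cY.2.

Lemma mem_ends_seam (s : seq 'I_n) u :
  (u \in ends [seq (inl (inr i), inr (inl i)) | i <- s]) =
  match u : node with inl (inr i) => i \in s | inr (inl i) => i \in s | _ => false end.
Proof.
elim: s u => [|i s IH] u; first by case: u => -[].
by rewrite /= !inE IH; case: u => -[] j.
Qed.

Lemma uniq_ends_seam (s : seq 'I_n) : uniq s ->
  uniq (ends [seq (inl (inr i), inr (inl i) : node) | i <- s]).
Proof.
elim: s => //= i s IH /andP[/negbTE is_ /IH us].
by rewrite !inE /= !mem_ends_seam is_ us.
Qed.

Lemma outer_inj : injective (@outer n).
Proof. by move=> [] i [] j //= [->]. Qed.

Lemma outer_seam x : outer x \notin ends seam.
Proof. by rewrite mem_ends_seam; case: x. Qed.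

Lemma seam_outer u : u \notin ends seam -> exists x, u = outer x.
Proof.
by rewrite mem_ends_seam; case: u => -[] i; rewrite ?mem_enum //; [exists (inl i)|exists (inr i)].
Qed.

(** Acting on D1 first and gluing afterwards is the same as gluing first, because the
    top points of D1 are not on the seam. The two scalars are compared as products, so
    that nothing has to be assumed invertible. *)
Lemma concat_blob_act i D1 D2 c D : concat D1 D2 c D ->
  exists2 c', concat (blob_act i D1) D2 c' (blob_act i D) &
    gen_weight delta 0 0 i (val D1) * c' = gen_weight delta 0 0 i (val D) * c.
Proof.
rewrite /concat; set cY := contract _ _ _ _ _ => -[<- ag].
have wfU : wf (dunion (val D1) (val D2)) by apply: dunion_wf; apply: blob_wf.
rewrite /= /gen /gen_weight; have [i0|i0] := eqVneq (nat_of_ord i) 0%N.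
  have [-> wE] := dunion_dot (0 : F) (inl i) (val D1) (val D2).
  have u : uniq (inl (inl i) :: ends seam).
    by rewrite /= (outer_seam (inl i)) (uniq_ends_seam (enum_uniq _)).
  have := contract_dot delta 0 0 1 u wfU; rewrite mul1r -wE contract_scale -/cY /=.
  case=> E1 E2; have [ag' w'] := agrees_dot (0 : F) (inl i) outer_inj ag.
  eexists; first by split; [reflexivity | rewrite E2; exact: ag'].
  by rewrite E1 mulrC -w'.
have ii := ord_pred_neq i0.
have [-> wE] := dunion_join delta 0 0 (inl (ord_pred i)) (inl i) (val D1) (val D2).
have u : uniq [:: inl (inl (ord_pred i)), inl (inl i) & ends seam].
  rewrite /= inE negb_or (outer_seam (inl i)) (outer_seam (inl (ord_pred i))) /=.
  by rewrite (inj_eq inl_inj) ii (uniq_ends_seam (enum_uniq _)).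
have := contract_step delta 0 0 (cX := (1, _)) u wfU; rewrite {1}/step /= mul1r -wE contract_scale -/cY /=.
case=> E1 E2; have [ag' w'] := agrees_join delta 0 0 (inl (ord_pred i)) (inl i) outer_inj ag.
eexists; first by split; [reflexivity | rewrite E2; exact: ag'].
by rewrite E1 mulrC -w'.
Qed.

(** The bottom points and those top points not yet passed sit at their old places. *)
Definition through (s : seq 'I_n) (phi : pt n -> node) (x : pt n) : node :=
  match x with inl i => if i \in s then inl (inl i) else phi x | inr _ => phi x end.

(** Each contraction slides an end of the second diagram along one of the vertical
    lines of the first, up to the outer top point. *)
Lemma contract_lines (s : seq 'I_n) (X : matching node) (phi : pt n -> node) Y : uniq s -> wf X ->
  {in s, forall i, [/\ X.1 (inl (inl i)) = inl (inr i), inl (inl i) \notin X.2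
                     & forall x : pt n, (phi x == inr (inl i)) = (x == inl i)]} ->
  {in s, forall i (x : pt n), phi x <> inl (inl i)} ->
  agrees phi Y X ->
  let cX := contract delta 0 0 [seq (inl (inr i), inr (inl i)) | i <- s] (1, X) in
  cX.1 = 1 /\ agrees (through s phi) Y cX.2.
Proof.
elim: s X phi => [|i s IH] X phi /=.
  by move=> _ wfX _ _ ag; split=> //; apply: eq_agrees ag => -[].
case/andP=> is_ us wfX H H' ag.
have [Xi Xm phiE] := H i (mem_head _ _).
have E := slide wfX Xi Xm (_ : inr (inl i) != inl (inl i)) (_ : inr (inl i) != inl (inr i)).
rewrite {1 2}/step /= (slide_weight _ _ _ wfX Xi Xm) // mulr1 E //.
have wfX' : wf (relabel (inl (inl i)) (inr (inl i)) X) by rewrite -E //; apply: join_wf.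
have := IH _ (fun x : pt n => tperm (inl (inl i)) (inr (inl i)) (phi x)) us wfX'.
case.
- move=> j js; have jis : j \in i :: s by rewrite inE js orbT.
  have [Xj Xjm phij] := H j jis.
  have ij : j != i by apply: contraNneq is_ => <-.
  have tE : tperm (inl (inl i)) (inr (inl i)) (inl (inl j)) = inl (inl j) :> node.
    by rewrite tpermD // eq_sym !(inj_eq inl_inj).
  split.
  + by rewrite ffunE tE Xj tpermD.
  + by rewrite inE tE.
  + move=> x; rewrite -phij -{1}(@tpermD _ (inl (inl i)) (inr (inl i)) (inr (inl j))) //.
      by rewrite (inj_eq perm_inj).
    by rewrite (inj_eq inr_inj) (inj_eq inl_inj) eq_sym.
- move=> j js x.
  have ij : j != i by apply: contraNneq is_ => <-.
  case: tpermP => [_ //|_ [E']|_ _]; last by apply: H'; rewrite inE js orbT.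
  by rewrite E' eqxx in ij.
- exact: agrees_relabel.
move=> c1 ag'; split=> //; apply: eq_agrees ag' => -[] j /=; last first.
  rewrite tpermD //; first by apply/eqP => /esym; apply: H'; rewrite mem_head.
  by rewrite eq_sym phiE.
rewrite inE; have [->|ji] := eqVneq j i.
  have /eqP -> : phi (inl i) == inr (inl i) by rewrite phiE.
  by rewrite (negbTE is_) tpermR.
case: (j \in s) => //=; rewrite tpermD //.
  by apply/eqP => /esym; apply: H'; rewrite mem_head.
by rewrite eq_sym phiE (inj_eq inl_inj).
Qed.

Lemma concat_line D : concat (line_diag n) D 1 D.
Proof.
have := @contract_lines (enum 'I_n) (dunion (val (line_diag n)) (val D)) inr (val D).
case=> //.
- exact: enum_uniq.
- by apply: dunion_wf; apply: blob_wf.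
- by move=> i _; split; rewrite ?ffunE ?inE //= ffunE.
- exact: agrees_dunionr.
move=> E ag; split=> //; apply: eq_agrees ag => -[] i //=.
by rewrite mem_enum.
Qed.

Section Product.
Variables (D1 D2 D : blob n) (c : F).
Hypothesis conc : concat D1 D2 c D.
Let U := dunion (val D1) (val D2).
Let wfU : wf U. Proof. by apply: dunion_wf; apply: blob_wf. Qed.

Lemma glue_edges : glue D1 D2 =2 edges U seam.
Proof.
have seamE u v : ((u, v) \in seam) =
    match u, v with inl (inr i), inr (inl j) => i == j | _, _ => false end.
  apply/mapP/idP => [[i _ [-> ->]] //|].
  by case: u v => -[] i [] [] j // /eqP ->; exists j; rewrite ?mem_enum.
move=> u v; rewrite /edges !seamE ffunE.
by case: u v => [x|x] [y|y] /=; rewrite ?(inj_eq inl_inj) ?(inj_eq inr_inj);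
  case: x y => i [] j; rewrite ?orbF // eq_sym.
Qed.

Let connE := eq_connect glue_edges.

Lemma is_loop_closedc : is_loop D1 D2 =1 closedc U seam.
Proof.
move=> u; congr (~~ _); apply/existsP/existsP => -[x].
  by rewrite connE => ux; exists (outer x); rewrite outer_seam.
by case/andP => /seam_outer[y ->] uy; exists y; rewrite connE.
Qed.

Lemma nmarks_nmark : nmarks D1 D2 =1 nmark U seam.
Proof.
by move=> u; congr (_./2); apply: eq_card => v; rewrite !inE connE; case: v.
Qed.

Lemma glue_conn_sym : connect_sym (glue D1 D2).
Proof. by move=> u v; rewrite !connE; apply: econn_sym. Qed.

Lemma nloops_classes : nloops D1 D2 = #|classes_of (edges U seam) (closedc U seam)|.
Proof.
rewrite /nloops n_comp_classes; first last.
- move=> u v uv; congr (~~ _); apply: eq_existsb => x.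
  by rewrite (same_connect1 glue_conn_sym uv).
- exact: glue_conn_sym.
apply: eq_card => C; apply/imsetP/imsetP => -[u]; rewrite inE => cu ->;
  (exists u; [by move: cu; rewrite inE is_loop_closedc | by apply/setP => v; rewrite !inE connE]).
Qed.

Lemma concat_zero_killed : concat_zero D1 D2 = killed U seam.
Proof. by apply: eq_existsb => u; rewrite is_loop_closedc nmarks_nmark. Qed.

Lemma concat_weight : c = if concat_zero D1 D2 then 0 else delta ^+ nloops D1 D2.
Proof.
have [_ _ _ _ cE] := tracks_contract delta wfU (uniq_ends_seam (enum_uniq 'I_n)).
by rewrite concat_zero_killed nloops_classes -cE; case: conc.
Qed.

(** The condition in [is_concat] determines the partners and the marks on the outer
    points, and the contraction satisfies it. *)
Lemma is_concatE D' : is_concat D1 D2 D' = (D' == D).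
Proof.
have [_ conn _ mk _] := tracks_contract delta wfU (uniq_ends_seam (enum_uniq 'I_n)).
case: conc => _ ag.
have lE x y : (x != y) && connect (glue D1 D2) (outer x) (outer y) = (link D x == y).
  rewrite connE conn ?inE ?outer_seam // (ag x).1 !(inj_eq outer_inj).
  case: eqP => //= <-; apply/esym/eqP; by case: (blob_wf D).
have mE x : (0 < nmarks D1 D2 (outer x))%N = (x \in marked D).
  by rewrite nmarks_nmark -mk ?inE ?outer_seam // (ag x).2.
apply/idP/eqP => [|->].
  case/andP => /forallP ll /forallP mm; apply: val_inj.
  rewrite [val D']surjective_pairing [val D]surjective_pairing; congr pair.
    apply/ffunP => x; have /forallP/(_ (link D x)) := ll x.
    by rewrite lE eqxx eqb_id => /eqP.
  by apply/setP => x; have /eqP := mm x; rewrite mE.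
by apply/andP; split; apply/forallP => x; rewrite ?mE //; apply/forallP => y; rewrite lE.
Qed.

Lemma diag_prodE : delta = - 2%:R -> diag_prod F D1 D2 = c *: diag_basis F D.
Proof.
move=> dE; rewrite /diag_prod concat_weight -dE; case: ifP => _; first by rewrite scale0r.
by rewrite (eq_bigl (pred1 D)) ?big_pred1_eq // => D'; apply: is_concatE.
Qed.
End Product.
End Concat.
(** * Undoing a cup-cap *)

Section Unjoin.
Variables (T : finType) (b : T -> nat).
Hypothesis b_inj : injective b.
Implicit Types (X : matching T) (p q r x y : T).

(** The move opposite to [join]: the cup p-q and an arc r-a are reconnected to p-a and
    q-r, and the mark of r-a, if any, goes to p-a. *)
Definition unjoin p q r X : matching T :=
  ([ffun x => if x == p then X.1 r else if x == X.1 r then p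
              else if x == q then r else if x == r then q else X.1 x],
   [set x | [&& x != q, x != r & if (x == p) || (x == X.1 r) then r \in X.2 else x \in X.2]]).

Lemma unjoinE p q r X x : (unjoin p q r X).1 x =
  if x == p then X.1 r else if x == X.1 r then p
  else if x == q then r else if x == r then q else X.1 x.
Proof. by rewrite ffunE. Qed.

Lemma unjoin_mark p q r X x : (x \in (unjoin p q r X).2) =
  [&& x != q, x != r & if (x == p) || (x == X.1 r) then r \in X.2 else x \in X.2].
Proof. by rewrite inE. Qed.

Section UnjoinCup.
Variables (X : matching T) (p q r : T).
Hypothesis wfX : wf X.
Hypothesis Xp : X.1 p = q.
Hypothesis pX : p \notin X.2.
Hypotheses (rp : r <> p) (rq : r <> q).

Lemma unjoin_wf : wf (unjoin p q r X).
Proof.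
have [inv nfix mk] := wfX; have ip := inv p; have iq := inv q; have ir := inv r.
have np := nfix p; have nq := nfix q; have nr := nfix r.
have mp := mk p; have mq := mk q; have mr := mk r.
split=> x; have ix := inv x; have nx := nfix x; have mx := mk x; rewrite ?unjoinE.
- by cases_eq.
- by cases_eq.
- by rewrite !unjoin_mark; cases_eq.
Qed.

Lemma join_unjoin : join p q (unjoin p q r X) = X.
Proof.
have [inv nfix mk] := wfX; have ip := inv p; have iq := inv q; have ir := inv r.
have np := nfix p; have nq := nfix q; have nr := nfix r.
have mp := mk p; have mq := mk q; have mr := mk r.
rewrite [RHS]surjective_pairing; congr pair.
  by apply/ffunP => x; have ix := inv x; have nx := nfix x; rewrite ffunE !unjoinE; cases_eq.
apply/setP => x; have ix := inv x; have nx := nfix x; have mx := mk x.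
have pX' := negbTE pX.
rewrite inE !unjoin_mark !unjoinE.
by cases_eq; rewrite ?orbF; congruence.
Qed.

Lemma join_weight_unjoin (F : fieldType) (delta gamma beta : F) :
  join_weight delta gamma beta p q (unjoin p q r X) = 1.
Proof.
have [inv _ _] := wfX; have ir := inv r.
rewrite /join_weight unjoinE !unjoin_mark !eqxx /= andbF.
by case: eqP => //; congruence.
Qed.

End UnjoinCup.

(** The reconnected arcs can be drawn if r-a borders the same region as the cup. It
    does when the points between q and r are matched among themselves; if no arc there
    is marked, then nothing marked gets enclosed by q-r. *)
Lemma planar_unjoin p q r X : planar b X -> b q = (b p).+1 -> X.1 p = q -> p \notin X.2 ->
  (b q < b r)%N ->
  (forall z, (b q < b z < b r)%N -> (b q < b (X.1 z) < b r)%N /\ z \notin X.2) ->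
  planar b (unjoin p q r X).
Proof.
move=> plX bpq Xp pX qr gap; case: (plX) => wfX nc ex; have [inv nfix mk] := wfX.
have rp : r <> p by move=> E; rewrite E in qr; lia.
have rq : r <> q by move=> E; rewrite E in qr; lia.
have [ip iq ir] : [/\ X.1 (X.1 p) = p, X.1 (X.1 q) = q & X.1 (X.1 r) = r] by split.
have np := nfix p; have nq := nfix q; have nr := nfix r.
(* The partner of r is outside the gap between q and r. *)
have side : (b (X.1 r) < b p \/ b r < b (X.1 r))%N.
  have : ~~ (b q < b (X.1 r) < b r)%N.
    by apply/negP => /[dup] /gap []; rewrite inv; lia.
  have := b_neq b_inj (_ : X.1 r <> p); have := b_neq b_inj (_ : X.1 r <> q).
  have := b_neq b_inj nr.
  move=> h1 h2 h3; have {}h2 := h2 _; have {}h3 := h3 _.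
  have : X.1 r <> q by congruence.
  have : X.1 r <> p by congruence.
  by move=> /h3 ? /h2 ?; lia.
have gap' z : z <> p -> z <> q -> z <> r -> z <> X.1 r ->
   (b q < b z < b r)%N <-> (b q < b (X.1 z) < b r)%N.
  by move=> *; split=> /gap[]; rewrite ?inv.
have sep z : z <> p -> z <> q -> z <> r -> z <> X.1 r ->
  [/\ (b q < b z < b r)%N <-> (b q < b (X.1 z) < b r)%N,
      (b p < b z < b (X.1 r) \/ b (X.1 r) < b z < b p)%N <->
      (b p < b (X.1 z) < b (X.1 r) \/ b (X.1 r) < b (X.1 z) < b p)%N
    & [/\ b z <> b p, b z <> b q, b z <> b r & b z <> b (X.1 r)] /\
      [/\ b (X.1 z) <> b p, b (X.1 z) <> b q, b (X.1 z) <> b r & b (X.1 z) <> b (X.1 r)]].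
  move=> zp zq zr zXr.
  have g := gap' z zp zq zr zXr.
  have iz := inv z.
  have z1 : X.1 z <> p by congruence.
  have z2 : X.1 z <> q by congruence.
  have z3 : X.1 z <> r by congruence.
  have z4 : X.1 z <> X.1 r by congruence.
  have [[[n1 n2] n3] n4] := (b_neq b_inj zp, b_neq b_inj zq, b_neq b_inj zr, b_neq b_inj zXr).
  have [[[m1 m2] m3] m4] := (b_neq b_inj z1, b_neq b_inj z2, b_neq b_inj z3, b_neq b_inj z4).
  have s := planar_sep b_inj plX zr zXr.
  by split=> //; lia.
have nbr : b (X.1 r) <> b r by apply: b_neq.
have nbq : b (X.1 r) <> b q by apply: b_neq => //; congruence.
have nbp : b (X.1 r) <> b p by apply: b_neq => //; congruence.
split; first exact: unjoin_wf.
  move=> x y; rewrite !unjoinE.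
  case: (x =P p) => [->|xp].
    case: (y =P p) => [->|yp]; first by lia.
    case: (y =P X.1 r) => [->|yXr]; first by lia.
    case: (y =P q) => [->|yq]; first by lia.
    case: (y =P r) => [->|yr]; first by lia.
    by have [_ ? [[? ? ? ?] [? ? ? ?]]] := sep y yp yq yr yXr; lia.
  case: (x =P X.1 r) => [->|xXr].
    case: (y =P p) => [->|yp]; first by lia.
    case: (y =P X.1 r) => [->|yXr]; first by lia.
    case: (y =P q) => [->|yq]; first by lia.
    case: (y =P r) => [->|yr]; first by lia.
    by have [_ ? [[? ? ? ?] [? ? ? ?]]] := sep y yp yq yr yXr; lia.
  case: (x =P q) => [->|xq].
    case: (y =P p) => [->|yp]; first by lia.
    case: (y =P X.1 r) => [->|yXr]; first by lia.
    case: (y =P q) => [->|yq]; first by lia.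
    case: (y =P r) => [->|yr]; first by lia.
    by have [? _ [[? ? ? ?] [? ? ? ?]]] := sep y yp yq yr yXr; lia.
  case: (x =P r) => [->|xr].
    case: (y =P p) => [->|yp]; first by lia.
    case: (y =P X.1 r) => [->|yXr]; first by lia.
    case: (y =P q) => [->|yq]; first by lia.
    case: (y =P r) => [->|yr]; first by lia.
    by have [? _ [[? ? ? ?] [? ? ? ?]]] := sep y yp yq yr yXr; lia.
  have [s1 s2 [[? ? ? ?] [? ? ? ?]]] := sep x xp xq xr xXr.
  case: (y =P p) => [->|yp]; first by lia.
  case: (y =P X.1 r) => [->|yXr]; first by lia.
  case: (y =P q) => [->|yq]; first by lia.
  case: (y =P r) => [->|yr]; first by lia.
  exact: nc.
move=> x; rewrite unjoin_mark => /and3P[/eqP xq /eqP xr].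
case: ifP => [pXr rS|/negbT]; last first.
  rewrite negb_or => /andP[/eqP xp /eqP xXr] xS y.
  have [s1 s2 [[? ? ? ?] [? ? ? ?]]] := sep x xp xq xr xXr.
  have gx : ~ (b q < b x < b r)%N by move=> /gap[_]; rewrite xS.
  have er := ex x xS r; have eXr := ex x xS (X.1 r).
  rewrite ir in eXr.
  rewrite !unjoinE (introF eqP xp) (introF eqP xXr) (introF eqP xq) (introF eqP xr).
  case: (y =P p) => [->|yp]; first by clear eXr s2; lia.
  case: (y =P X.1 r) => [->|yXr]; first by clear er s2; lia.
  case: (y =P q) => [->|yq]; first by clear er eXr s1 s2; lia.
  case: (y =P r) => [->|yr]; first by clear er eXr s1 s2; lia.
  exact: ex.
suff arc y : ~ (b y < minn (b p) (b (X.1 r)) /\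
                maxn (b p) (b (X.1 r)) < b ((unjoin p q r X).1 y))%N.
  move=> y; rewrite {1 2}unjoinE; case/orP: pXr => /eqP ->; rewrite eqxx; first exact: arc.
  by case: eqP => [?|_]; [congruence | rewrite minnC maxnC; apply: arc].
rewrite unjoinE.
case: (y =P p) => [->|yp]; first by lia.
case: (y =P X.1 r) => [->|yXr]; first by lia.
case: (y =P q) => [->|yq]; first by lia.
case: (y =P r) => [->|yr]; first by lia.
have ey := ex r rS y.
have [s1 s2 [[? ? ? ?] [? ? ? ?]]] := sep y yp yq yr yXr.
have yr' : r <> y by congruence.
have yXr' : r <> X.1 y by congruence.
by have := planar_sep b_inj plX yr' yXr'; lia.
Qed.
End Unjoin.
(** * Every blob diagram is a product of generators *)

Section Generation.
Variable n : nat.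
Implicit Types (i j : 'I_n) (D : blob n) (X : matching (pt n)) (x y z : pt n).

Definition col x : nat := match x with inl i => i | inr i => i end.

(** The number of units an arc spans horizontally. A marked arc is drawn via the left
    side of the rectangle: from one end to the side, and back to the other end. *)
Definition arc_extent X x : nat :=
  if x \in X.2 then (col x + col (X.1 x)).+1%N
  else ((col x - col (X.1 x)) + (col (X.1 x) - col x))%N.

Definition extent X : nat := (\sum_x arc_extent X x)%N.

(** Without arcs between top points every strand runs from top to bottom, and being
    noncrossing they keep their order. The strands to the right of the first one are
    not exposed. *)
Lemma no_top_line D : (forall i j, link D (inl i) <> inl j) ->
  (forall i, i = 0%N :> nat -> inl i \notin marked D) -> D = line_diag n.
Proof.
move=> notop nomark; have [[inv nfix mk] nc ex] := blob_planar D.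
rewrite -[(val D).1]/(link D) -[(val D).2]/(marked D) in inv nfix mk nc ex.
(* The permutation drawn by the strands; the default value i is never used. *)
pose f i : 'I_n := if link D (inl i) is inr j then j else i.
have fE i : link D (inl i) = inr (f i).
  by rewrite /f; case E : (link D (inl i)) => [j|//]; case: (notop _ _ E).
have f_inj : injective f.
  move=> i j fij; have : link D (inl i) = link D (inl j) by rewrite !fE fij.
  by move/(congr1 (link D)); rewrite !inv => -[].
have f_mono i j : (i < j)%N -> (f i < f j)%N.
  move=> ij; have := nc (inl i) (inl j); rewrite !fE /=.
  have : f i <> f j :> nat by move/val_inj/f_inj => E; rewrite E ltnn in ij.
  by have := ltn_ord i; have := ltn_ord j; have := ltn_ord (f i); have := ltn_ord (f j); lia.
have mono_ge (g : 'I_n -> 'I_n) : (forall i j, (i < j)%N -> (g i < g j)%N) -> forall i, (i <= g i)%N.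
  move=> gm [k Hk]; elim: k Hk => // k IH Hk /=.
  by have := IH (ltnW Hk); have := gm (Ordinal (ltnW Hk)) (Ordinal Hk) (ltnSn k); simpl; lia.
have fid i : f i = i.
  apply: val_inj => /=; apply/eqP; rewrite eqn_leq (mono_ge f) // andbT.
  have := mono_ge (invF f_inj) _ (f i); rewrite invF_f; apply=> a b ab.
  rewrite ltnNge leq_eqVlt; apply/negP => /orP[/eqP/val_inj E|/f_mono].
    by move: ab; rewrite -(f_invF f_inj a) -(f_invF f_inj b) E ltnn.
  by rewrite !f_invF; lia.
have lE i : link D (inl i) = inr i by rewrite fE fid.
apply: val_inj; rewrite [val D]surjective_pairing; congr pair.
  by apply/ffunP => -[] i; rewrite ffunE -/(link D) ?lE // -lE inv.
apply/setP => x; rewrite inE; apply/negP.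
have top i : inl i \notin (val D).2.
  have [i0|i0] := eqVneq (nat_of_ord i) 0%N; first exact: nomark.
  apply/negP => /ex /(_ (inl (Ordinal (leq_ltn_trans (leq0n i) (ltn_ord i))))).
  rewrite !lE /= => E; apply: E; have := ltn_ord i; lia.
case: x => i; first exact/negP/top.
by rewrite -lE -/(marked D) mk; apply/negP/top.
Qed.

(** Among the arcs under a given top arc, a shortest one joins neighbours. *)
Lemma top_arc_cup D i j : link D (inl i) = inl j -> (i < j)%N ->
  exists2 k : 'I_n, (i < k <= j)%N & k != 0%N :> nat /\ link D (inl (ord_pred k)) = inl k.
Proof.
have [[inv nfix mk] nc _] := blob_planar D.
rewrite -[(val D).1]/(link D) in inv nfix nc.
have [m] := ubnP (j - i); elim: m i j => // m IH i j; rewrite ltnS => jim lij ij.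
have [jE|jE] := eqVneq (nat_of_ord j) i.+1.
  exists j; first by rewrite ij leqnn.
  have j0 : j != 0%N :> nat by rewrite jE.
  split=> //; rewrite -lij; congr (link D (inl _)).
  by apply: val_inj; rewrite [LHS]ord_predE ?lt0n // jE.
have Hk : (i.+1 < n)%N by have := ltn_ord j; lia.
pose k := Ordinal Hk.
have lji : link D (inl j) = inl i by rewrite -lij inv.
have n1 := nc (inl i) (inl k); have n2 := nc (inl k) (inl i).
have := nfix (inl k); have := inv (inl k).
have lki : link D (inl k) <> inl i.
  by move=> E; have := inv (inl k); rewrite E lij => -[E']; rewrite E' /= in jE; lia.
have lkj : link D (inl k) <> inl j.
  by move=> E; have := inv (inl k); rewrite E lji => -[/(congr1 (@nat_of_ord n))] /=; lia.
have := n1; rewrite lij; case E : (link D (inl k)) lki lkj => [l|l] lki lkj /=; last first.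
  by have := ltn_ord l; have := ltn_ord j; lia.
move=> n1' ilk kl.
have li : l <> i :> nat by move=> /val_inj Ei; apply: lki; rewrite Ei.
have lj : l <> j :> nat by move=> /val_inj Ei; apply: lkj; rewrite Ei.
have lk : l <> i.+1 :> nat by move=> H; apply: kl; congr inl; apply: val_inj.
have := nc (inl l) (inl i); rewrite ilk lij /= => n3.
have := IH k l _ E; case; rewrite /=; try lia.
by move=> h Hh; exists h => //; lia.
Qed.

Lemma extent_unmark D i : i = 0%N :> nat -> inl i \in marked D ->
  exists D1, [/\ D = blob_act i D1, (extent (val D1) < extent (val D))%N
    & forall (F : fieldType) (delta gamma beta : F), gen_weight delta gamma beta i (val D1) = 1].
Proof.
move=> i0 iD; have [[inv nfix mk] nc ex] := blob_planar D.
pose X1 : matching (pt n) := ((val D).1, [set x in (val D).2 | (x != inl i) && (x != (val D).1 (inl i))]).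
have wfD := blob_wf D.
have X1P : is_blob X1.
  apply/is_blobP; split=> //.
    split=> // x; rewrite !inE /= mk -(link_swap _ _ wfD) inv.
    by rewrite (link_swap _ _ wfD); congr (_ && _); rewrite andbC.
  by move=> x; rewrite inE => /andP[/ex].
exists (Sub X1 X1P); split.
- apply: val_inj; rewrite /= /gen i0 eqxx [LHS]surjective_pairing; congr pair.
  apply/setP => x; rewrite !inE /=.
  case: eqP => [->|_] /=; first by rewrite iD.
  by case: eqP => [->|_] /=; rewrite ?mk ?iD // andbT.
- rewrite /extent (bigD1 (inl i)) //= [X in (_ < X)%N](bigD1 (inl i)) //= -addSn.
  apply: leq_add; last apply: leq_sum => x _.
    by rewrite /arc_extent /= !inE eqxx iD /= ?andbF i0 subn0 sub0n.
  rewrite /arc_extent /= !inE; case: (x \in (val D).2) => //=; case: ifP => // _.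
  by move: (col _) (col _) => a c; clear; lia.
- by move=> *; rewrite /gen_weight i0 eqxx /dot_weight /= !inE eqxx andbF.
Qed.

(** Vertical lines match the points weakly to the right of i among themselves. *)
Lemma right_even i : ~~ odd #|[set x : pt n | (i <= col x)%N]|.
Proof.
apply: (@even_invol _ (line_fun n)) => -[] x; by rewrite ?inE !ffunE.
Qed.

(** The vertical line between p and q is crossed once less by the cup and once less by
    the other arc, each counted from both of its ends. *)
Lemma extent_unjoin X p q r : wf X -> X.1 p = q -> p \notin X.2 ->
  col q = (col p).+1 -> r <> p -> r <> q -> (col q <= col r)%N ->
  (col (X.1 r) <= col p)%N || (r \in X.2) ->
  (extent (unjoin p q r X) < extent X)%N.
Proof.
move=> wfX Xp pX pq rp rq qr crossing; have [inv nfix mk] := wfX.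
have [[ip iq] ir] := (inv p, inv q, inv r).
have nr := nfix r; have np := nfix p.
have /eqP qp' : q <> p by rewrite -Xp.
have /eqP rp' := rp; have /eqP rq' := rq.
have /eqP ap' : X.1 r <> p by congruence.
have /eqP aq' : X.1 r <> q by congruence.
have /eqP ar' := nr.
rewrite /extent (bigD1 p) //= (bigD1 q) //= (bigD1 r) /=; last by rewrite rp' rq'.
rewrite (bigD1 (X.1 r)) /=; last by rewrite ap' aq' ar'.
rewrite [X in (_ < X)%N](bigD1 p) //= [X in (_ < _ + X)%N](bigD1 q) //=.
rewrite [X in (_ < _ + (_ + X))%N](bigD1 r) /=; last by rewrite rp' rq'.
rewrite [X in (_ < _ + (_ + (_ + X)))%N](bigD1 (X.1 r)) /=; last by rewrite ap' aq' ar'.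
rewrite (eq_bigr (arc_extent X)); last first.
  move=> x /andP[/andP[/andP[xp xq] xr] xa]; rewrite /arc_extent unjoinE unjoin_mark.
  by rewrite (negbTE xp) (negbTE xq) (negbTE xr) (negbTE xa).
move: (\sum_(_ | _) _)%N => rest.
have qX : q \notin X.2 by rewrite -Xp mk.
have Xq : X.1 q = p by rewrite -Xp inv.
rewrite /arc_extent !unjoinE !unjoin_mark Xp Xq ir mk (negbTE pX) (negbTE qX) !eqxx.
have qp2 := qp'; have rp2 := rp'; have rq2 := rq'; have ap2 := ap'; have aq2 := aq'; have ar2 := ar'.
rewrite eq_sym in qp2; rewrite eq_sym in rp2; rewrite eq_sym in rq2; rewrite eq_sym in ap2; rewrite eq_sym in aq2; rewrite eq_sym in ar2.
have sep := (negbTE qp', negbTE rp', negbTE rq', negbTE ap', negbTE aq', negbTE ar',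
  (negbTE qp2, negbTE rp2, negbTE rq2, negbTE ap2, negbTE aq2, negbTE ar2)).
rewrite ?sep /= ?eqxx ?sep /=.
move: crossing; case: (r \in X.2) => /=; rewrite ?orbF;
  move: pq qr; move: (col p) (col q) (col r) (col (X.1 r)) => a c d e; clear; lia.
Qed.

(** If the leftmost top point has a mark, U_0 splits off. Otherwise take the first cup
    p-q on the top. By parity some other arc crosses the vertical line between p and q,
    where a marked arc to the right of that line counts as crossing, being drawn via
    the left side. The first such arc after q borders the region of the cup, and
    undoing the cup against it shortens the diagram. *)
Lemma blob_reduce D : D <> line_diag n ->
  exists i D1, [/\ D = blob_act i D1, (extent (val D1) < extent (val D))%N
    & forall (F : fieldType) (delta gamma beta : F), gen_weight delta gamma beta i (val D1) = 1].
Proof.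
move=> Dline; have [[inv nfix mk] nc ex] := blob_planar D.
have wfD := blob_wf D.
rewrite -[(val D).1]/(link D) -[(val D).2]/(marked D) in inv nfix mk nc ex.
have [/existsP[i /andP[/eqP i0 iD]]|] := boolP [exists i : 'I_n, (i == 0%N :> nat) && (inl i \in marked D)].
  by have [D1 H] := extent_unmark i0 iD; exists i, D1.
move=> /existsPn unmark0.
have nomark i : i = 0%N :> nat -> inl i \notin marked D.
  by move=> i0; have := unmark0 i; rewrite i0.
pose cup := [pred i : 'I_n | (i != 0%N :> nat) && (link D (inl (ord_pred i)) == inl i)].
have [i0 cup0] : exists i, cup i.
  have [/existsP[i /existsP[j /eqP lij]]|] := boolP [exists i : 'I_n, [exists j : 'I_n, link D (inl i) == inl j]].
    have : (i < j)%N || (j < i)%N.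
      by rewrite -neq_ltn; apply/eqP => /val_inj E; apply: (nfix (inl i)); rewrite lij E.
    have lji : link D (inl j) = inl i by rewrite -lij inv.
    by case/orP => ij; [have [k _ [k0 lk]] := top_arc_cup lij ij | have [k _ [k0 lk]] := top_arc_cup lji ij];
      exists k; rewrite /= k0 lk eqxx.
  move/existsPn => notop; case: Dline; apply: no_top_line => // i j E.
  by have /existsPn/(_ j) := notop i; rewrite E eqxx.
case: (arg_minnP (fun i : 'I_n => nat_of_ord i) cup0) => i /andP[iN0 /eqP lp] imin {i0 cup0}.
have ipE : ord_pred i = i.-1 :> nat by rewrite ord_predE // lt0n.
set p := inl (ord_pred i) in lp; set q := inl i in lp.
have lq : link D q = p by rewrite -lp inv.
have bp : bpos p = i.-1 by exact: ipE.
have bq : bpos q = i by [].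
have colp : col p = i.-1 by exact: ipE.
have pE : p = inl (ord_pred i) by [].
clearbody p.
have pD : p \notin marked D.
  apply/negP => /[dup] pD /ex; rewrite lp => exp.
  pose z0 := inl (Ordinal (leq_ltn_trans (leq0n i) (ltn_ord i))) : pt n.
  have z0D : z0 \notin marked D by apply: nomark.
  have zp : z0 <> p by move=> E; rewrite E pD in z0D.
  have zq : z0 <> q by move=> E; rewrite E -lp mk pD in z0D.
  have lzp : link D z0 <> p by move=> E; apply: zq; rewrite -[z0]inv E.
  have lzq : link D z0 <> q by move=> E; apply: zp; rewrite -[z0]inv E.
  have /(b_neq (@bpos_inj n)) := lzp; have /(b_neq (@bpos_inj n)) := lzq.
  have /(b_neq (@bpos_inj n)) := zp.
  have := exp z0; rewrite bp bq [bpos z0]/=.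
  case E : (link D z0) (nfix z0) => [j|j] nz /=; last by have := ltn_ord j; have := ltn_ord i; lia.
  have [j0|j0] := posnP j; first by case: nz; congr inl; apply: val_inj.
  have [k /andP[k0 kj] [kN0 lk]] := top_arc_cup E j0.
  by have := imin k; rewrite inE kN0 lk eqxx => /(_ isT); lia.
(* The points to the right of the cut whose arc crosses the cut, a marked arc being drawn via the left side. *)
pose cr z := [&& (i <= col z)%N, z != q & (col (link D z) < i)%N || (z \in marked D)].
have [r0 crr0] : exists z, cr z.
  apply/existsP; apply: contraT => /existsPn nocr.
  have := right_even i; rewrite (cardsD1 q) inE leqnn oddD /=.
  rewrite (negbTE (even_invol inv nfix _)) // => x; rewrite !inE => /andP[xq ix].
  have := nocr x; rewrite /cr ix xq /= negb_or -leqNgt => /andP[ilx _].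
  rewrite ilx andbT; apply: contra xq => /eqP lx; apply/eqP.
  have xp : x = p by rewrite -lq -lx inv.
  by move: ix; rewrite xp colp; move: iN0; case: (nat_of_ord i) => //= k _; rewrite ltnn.
case: (arg_minnP (@bpos n) crr0) => r /and3P[ir rq crr] rmin {r0 crr0}.
(* The points to the right of the cut are consecutive on the boundary, starting with q. *)
have posR z : (i <= col z)%N = (i <= bpos z <= (n + n) - i.+1)%N.
  by case: z => z /=; have := ltn_ord z; have := ltn_ord i; lia.
have bpq : bpos q = (bpos p).+1 by rewrite bp bq prednK // lt0n.
have rq' : bpos r <> i by move=> E; case/eqP: rq; apply: bpos_inj.
have qr : (bpos q < bpos r)%N by have := posR r; rewrite ir /=; lia.
(* Points between q and r do not cross the cut, as r is the first one that does. Were one of them matched beyond r, the arc of r would be nested inside that arc; then r is on the right of the cut with its partner, hence marked, but not exposed. *)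
have gap z : (bpos q < bpos z < bpos r)%N -> (bpos q < bpos (link D z) < bpos r)%N /\ z \notin marked D.
  move=> qzr.
  have iz : (i <= col z)%N by move: (posR z) (posR r); rewrite ir; rewrite /= in qzr; lia.
  have zq : z != q by apply/eqP => E; move: qzr; rewrite E ltnn.
  have := rmin z; rewrite /cr iz zq /=.
  case: (boolP ((col (link D z) < i)%N || (z \in marked D))) => [_|]; first by lia.
  rewrite negb_or -leqNgt => /andP[ilz zD] _; split=> //.
  have lzq : link D z <> q.
    move=> E; have zp : z = p by rewrite -lq -E inv.
    by move: qzr; rewrite zp bpq; lia.
  have /(b_neq (@bpos_inj n)) := lzq.
  have := posR (link D z); rewrite ilz.
  have lzr : link D z <> r.
    move=> E; have lr : link D r = z by rewrite -E inv.
    by move: crr; rewrite lr ltnNge iz /= => rD; rewrite -lr mk rD in zD.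
  have /(b_neq (@bpos_inj n)) := lzr.
  have zr : r <> z by move=> E; move: qzr; rewrite E; lia.
  have lzr' : r <> link D z by move=> E; apply: lzr.
  have sep := planar_sep (@bpos_inj n) (blob_planar D) zr lzr'.
  rewrite -[(val D).1]/(link D) in sep.
  move=> h1 h2 h3; case: (ltnP (bpos (link D z)) (bpos r)) => [h4|h4].
    by rewrite bq in h3 *; lia.
  have rin : (bpos z < bpos r < bpos (link D z))%N by lia.
  have lrin : (bpos z < bpos (link D r) < bpos (link D z))%N.
    by case: sep => /(_ (or_introl rin)) [//|]; lia.
  have irl : (i <= col (link D r))%N.
    by rewrite posR; rewrite bq in qzr; lia.
  move: crr; rewrite ltnNge irl /= => /ex/(_ z) enc; case: enc.
  case/andP: rin => zr1 zr2; case/andP: lrin => zl1 zl2.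
  by rewrite leq_min zr1 zl1 gtn_max zr2 zl2.
have rp : r <> p by move=> E; rewrite E in qr; lia.
have pl := planar_unjoin (@bpos_inj n) (blob_planar D) bpq lp pD qr gap.
have D1P : is_blob (unjoin p q r (val D)) by apply/is_blobP.
exists i, (Sub _ D1P); split.
- apply: val_inj; by rewrite /= /gen (negbTE iN0) -pE join_unjoin //; apply/eqP.
- apply: extent_unjoin => //; [by rewrite colp /= prednK // lt0n | by apply/eqP |].
  by rewrite colp -[X in (_ <= X)%N]/(i.-1) -ltnS prednK ?lt0n.
- move=> F delta gamma beta; rewrite /gen_weight (negbTE iN0) -pE.
  by apply: join_weight_unjoin => //; apply/eqP.
Qed.

(** The weight 1 says that no loop and no double mark arises: the factorization is
    reduced, for all values of the three scalars. *)
Lemma blob_gen_ind (P : blob n -> Prop) : P (line_diag n) ->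
  (forall i D, (forall (F : fieldType) (delta gamma beta : F), gen_weight delta gamma beta i (val D) = 1) ->
     P D -> P (blob_act i D)) ->
  forall D, P D.
Proof.
move=> P1 PS D; have [m] := ubnP (extent (val D)); elim: m D => // m IH D; rewrite ltnS => Dm.
have [->//|/eqP/blob_reduce[i [D1 [E lt w]]]] := eqVneq D (line_diag n).
by rewrite E; apply: (PS i D1 w); apply: IH; apply: leq_trans lt Dm.
Qed.

End Generation.
(** * There are at least binomial(2n, n) blob diagrams *)

Section NatScope.
Local Open Scope nat_scope.

Lemma bpos_lt n (x : pt n) : bpos x < n + n.
Proof. by case: x => i /=; have := ltn_ord i; lia. Qed.

Lemma bpos_surj n k : k < n + n -> exists x : pt n, bpos x = k.
Proof.
move=> kn; have [lt|ge] := ltnP k n; first by exists (inl (Ordinal lt)).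
have H : n + n - k.+1 < n by lia.
by exists (inr (Ordinal H)) => /=; lia.
Qed.

Section Walk.
Variables (n : nat) (s : nat -> bool).
Let N := n + n.

Definition ups k := \sum_(j < k) s j.
(** The distance from the axis of the walk with up-steps where s holds, that is,
    |2 ups - k| with truncated subtraction. *)
Definition height k := (2 * ups k - k) + (k - 2 * ups k).

Lemma upsS k : ups k.+1 = ups k + s k.
Proof. by rewrite /ups big_ord_recr. Qed.

Lemma height0 : height 0 = 0. Proof. by rewrite /height /ups big_ord0. Qed.

Lemma heightS k : height k.+1 = (height k).+1 \/ (height k.+1).+1 = height k.
Proof. by rewrite /height upsS; case: (s k) => /=; lia. Qed.

(** Step k leaves the height it has before, and step q is the first one to return to it. *)
Definition arch k q := [&& k < q, height k == height q.+1 & all (fun r => height k < height r) (iota k.+1 (q - k))].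

Lemma archP k q : reflect [/\ k < q, height k = height q.+1 & forall r, k < r <= q -> height k < height r] (arch k q).
Proof.
apply: (iffP and3P) => -[kq /eqP E H]; split=> //; try exact/eqP.
  move=> r Hr; apply: (allP H); rewrite mem_iota; lia.
by apply/allP => r; rewrite mem_iota => Hr; apply: H; lia.
Qed.

Definition mates (x y : pt n) := arch (bpos x) (bpos y) || arch (bpos y) (bpos x).

Lemma mates_sym x y : mates x y = mates y x.
Proof. by rewrite /mates orbC. Qed.

Lemma mates_uniq x y z : mates x y -> mates x z -> y = z.
Proof.
move=> xy xz; apply: bpos_inj; move: xy xz; rewrite /mates.
move: (bpos x) (bpos y) (bpos z) => k q r.
case/orP => /archP[kq E H] /orP[] /archP[kr E' H'].
- by have := H r.+1; have := H' q.+1; case: (ltngtP q r) => //; lia.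
- by have := H k.+1; have := H' k; lia.
- by have := H' k.+1; have := H k; lia.
- by have := H r; have := H' q; case: (ltngtP q r) => //; lia.
Qed.

Hypothesis closed_walk : height N = 0.

Lemma mates_ex x : exists y, mates x y.
Proof.
have := bpos_lt x; rewrite /mates; move: (bpos x) => k kN.
suff [q qN kq] : exists2 q, q < n + n & arch k q || arch q k.
  by have [y yq] := bpos_surj qN; exists y; rewrite yq.
have [up|down] := heightS k.
  have ex : exists q, (k < q) && (height q.+1 <= height k).
    exists N.-1; rewrite prednK ?closed_walk; last by rewrite /N; lia.
    have : k.+1 != N by apply/eqP => E; move: up; rewrite E closed_walk.
    by rewrite /N in kN *; lia.
  case: (ex_minnP ex) => q /andP[kq aq] qmin.
  have H r : k < r <= q -> height k < height r.
    case: r => // r /andP[kr rq]; have [->|kr'] := eqVneq r k; first by rewrite up.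
    by rewrite ltnNge; apply/negP => ar; have := qmin r; rewrite ar; lia.
  have qN : q < N.
    have := qmin N.-1; rewrite prednK ?closed_walk; last by rewrite /N; lia.
    have : k.+1 != N by apply/eqP => E; move: up; rewrite E closed_walk.
    by rewrite /N in kN *; lia.
  exists q => //; apply/orP; left; apply/archP; split=> //.
  by have := H q; have := heightS q; lia.
pose P q := (q < k) && (height q <= height k.+1).
have ex : exists q, P q.
  by exists 0; rewrite /P height0; case: k down {kN P} => //; rewrite height0.
have ub q : P q -> q <= k by case/andP => /ltnW.
case: (ex_maxnP ex ub) => q /andP[qk aq] qmax.
have H r : q < r <= k -> height k.+1 < height r.
  case/andP => qr; rewrite leq_eqVlt => /orP[/eqP->|rk]; first by lia.
  by rewrite ltnNge; apply/negP => ar; have := qmax r; rewrite /P ar rk /=; lia.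
exists q; first by lia.
apply/orP; right; apply/archP.
have E : height q = height k.+1 by have := H q.+1; have := heightS q; lia.
by split=> // r /H; rewrite E.
Qed.

Definition arches : {ffun pt n -> pt n} := [ffun x => odflt x [pick y | mates x y]].

Lemma arches_mates x : mates x (arches x).
Proof.
rewrite ffunE; case: pickP => //= no; have [y] := mates_ex x.
by rewrite no.
Qed.

Lemma archesE x y : mates x y -> arches x = y.
Proof. exact/mates_uniq/arches_mates. Qed.

(** The arcs over the excursions below the axis: those at height 0 whose first step
    goes down. *)
Definition below_axis : {set pt n} :=
  [set x | let m := minn (bpos x) (bpos (arches x)) in (height m == 0) && (2 * ups m.+1 < m.+1)].

Lemma arch_arches x : bpos x < bpos (arches x) -> arch (bpos x) (bpos (arches x)).
Proof.
move=> lt; have := arches_mates x; rewrite /mates => /orP[] // /archP[lt'].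
by have := ltn_trans lt lt'; rewrite ltnn.
Qed.

(** Arcs are matched steps away from the axis and back. The height exceeds that of the
    outer arc strictly inside it, so arcs at height 0 are exposed. *)
Lemma walk_blob : is_blob (arches, below_axis).
Proof.
have inv x : arches (arches x) = x by apply: archesE; rewrite mates_sym arches_mates.
apply/is_blobP; split.
- split=> x /=; first exact: inv.
    by move=> E; have := arches_mates x; rewrite E /mates orbb /arch ltnn.
  by rewrite !inE inv minnC.
- move=> x y /= [/andP[xy yx'] xy'].
  have /archP[_ E H] := arch_arches (ltn_trans xy yx').
  have /archP[_ E' H'] := arch_arches (ltn_trans yx' xy').
  by have := H (bpos y); have := H' (bpos (arches x)).+1; lia.
- move=> x; rewrite inE /= => /andP[/eqP a0 _] y [ym my].
  have yl : bpos y < bpos (arches y) by lia.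
  have /archP[_ _ H] := arch_arches yl.
  by have := H (minn (bpos x) (bpos (arches x))); lia.
Qed.

Definition walk_diag : blob n := Sub (arches, below_axis) walk_blob.

Lemma up_arches x : (bpos x < bpos (arches x)) = (height (bpos x).+1 == (height (bpos x)).+1).
Proof.
have := arches_mates x; rewrite /mates => /orP[] /archP[lt E H].
  by have := H (bpos x).+1; have := heightS (bpos x); lia.
by have := H (bpos x); lia.
Qed.

Lemma mem_below_axis x : height (bpos x) = 0 -> (x \in below_axis) = (2 * ups (bpos x).+1 < (bpos x).+1).
Proof.
move=> a0; have lt : bpos x < bpos (arches x) by rewrite up_arches; have := heightS (bpos x); lia.
by rewrite inE /=; have -> : minn (bpos x) (bpos (arches x)) = bpos x; [lia | rewrite a0 eqxx].
Qed.

End Walk.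

(** The arcs tell whether a step leaves the axis or returns to it. The direction is
    then known, except for a step that starts on the axis, where the mark tells it. *)
Lemma walk_diag_inj n s t (Hs : height s (n + n) = 0) (Ht : height t (n + n) = 0) :
  walk_diag Hs = walk_diag Ht -> forall k, k < n + n -> s k = t k.
Proof.
move/(congr1 val) => [Ea En].
suff E k : k <= n + n -> ups s k = ups t k.
  move=> k kn; have := E k (ltnW kn); have := E _ kn; rewrite !upsS => /[swap] ->.
  by case: (s k); case: (t k) => //=; lia.
elim: k => [|k IH] kn; first by rewrite /ups !big_ord0.
have {}IH := IH (ltnW kn); have [x xk] := bpos_surj kn.
have aE : height s k = height t k by rewrite /height IH.
have [a0|a0] := eqVneq (height s k) 0.
  have := mem_below_axis Hs (x := x); have := mem_below_axis Ht (x := x); rewrite xk -aE En.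
  by move=> /(_ a0) -> /(_ a0); rewrite !upsS IH; move: a0; rewrite /height; case: (s k); case: (t k); lia.
have := up_arches Hs x; rewrite Ea (up_arches Ht x) xk.
by move: a0 aE; rewrite /height !upsS IH; case: (s k); case: (t k); lia.
Qed.

Lemma card_blob_ge n : 'C(2 * n, n) <= #|{: blob n}|.
Proof.
rewrite mul2n -addnn.
pose s (A : {set 'I_(n + n)}) k := if insub k is Some i then i \in A else false.
have Hs (A : {set 'I_(n + n)}) : #|A| = n -> height (s A) (n + n) = 0.
  move=> An; rewrite /height; have -> : ups (s A) (n + n) = n; last by lia.
  rewrite -[RHS]An /ups -sum1_card [RHS]big_mkcond /=; apply: eq_bigr => i _.
  by rewrite /s valK; case: (i \in A).
pose S := {A : {set 'I_(n + n)} | #|A| == n}.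
pose f (A : S) : blob n := walk_diag (Hs (val A) (eqP (valP A))).
have f_inj : injective f.
  move=> A B /walk_diag_inj AB; apply: val_inj; apply/setP => i.
  by have := AB i (ltn_ord i); rewrite /s valK.
apply: leq_trans (leq_card f f_inj).
rewrite card_sig -(card_ord (n + n)) -card_draws card_ord.
by rewrite subset_leq_card //; apply/subsetP => A; rewrite !inE.
Qed.

End NatScope.
(** * Normal words in an algebra with the blob relations *)

(** The number of ways to complete a normal word in the first m generators by d further
    generators, when the least end allowed for its next block is m - g and not 0. *)
Fixpoint ballot d g : nat :=
  if d is d'.+1 then (\sum_(h < g.+2) ballot d' h)%N else 1%N.

Lemma sum_ballot d m :
  (\sum_(h < m) ballot d h + 'C(2 * d + m + 1, d) = 'C(2 * d + m + 1, d.+1))%N.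
Proof.
elim: d m => [|d IHd]; elim=> [|m IHm].
- by rewrite big_ord0 bin0 bin1.
- by rewrite big_ord_recr /=; move: IHm => /=; rewrite !bin0 !bin1; lia.
- rewrite big_ord0 add0n; have -> : (2 * d.+1 + 0 + 1 = d.+1 + d.+2)%N by lia.
  rewrite -[in RHS]bin_sub ?leq_addl //; congr 'C(_, _); lia.
- have := IHd m.+2; rewrite -[(\sum_(h < m.+2) _)%N]/(ballot d.+1 m) big_ord_recr.
  have -> : (2 * d.+1 + m.+1 + 1 = (2 * d.+1 + m + 1).+1)%N by lia.
  have -> : (2 * d + m.+2 + 1 = 2 * d.+1 + m + 1)%N by lia.
  by rewrite [in X in _ -> X]binS [in X in _ -> _ = X]binS; move: IHm => /=; lia.
Qed.

(** The number of ways to complete a normal word in the first m generators, with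
    lower bound s for the end of its next block, by d further generators. The bound 0
    is special, because blocks ending in U_0 may repeat. *)
Definition completions d m s : nat :=
  if s == 0%N then 'C(2 * d + m, d) else ballot d (m - s).

(** The next generator U_m is either omitted or starts a block U_m ... U_j with j at
    least s. *)
Lemma completionsS d m s : (s <= m)%N ->
  (completions d.+1 m s = completions d m.+1 s +
     \sum_(j <- iota s (m.+1 - s)) completions d m.+1 (if j == 0 then 0 else j.+1))%N.
Proof.
have sumE t : (0 < t <= m.+1)%N ->
   (\sum_(j <- iota t (m.+1 - t)) completions d m.+1 (if j == 0 then 0 else j.+1) =
    \sum_(h < m.+1 - t) ballot d h)%N.
  move=> Ht; rewrite -[in RHS](big_mkord xpredT) -[LHS]/(\sum_(t <= j < m.+1) _)%N big_nat_rev /=.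
  rewrite -{1}[t]add0n big_addn; apply: eq_big_nat => j Hj.
  rewrite ifN; last by lia.
  by rewrite /completions /=; congr ballot; lia.
move=> sm; have [->|s0] := posnP s.
  rewrite subn0 [iota _ _]/= big_cons /=.
  have := sumE 1%N isT; rewrite subSS subn0 => ->.
  rewrite /completions /=; have := sum_ballot d m.
  have -> : (2 * d.+1 + m = (2 * d + m + 1).+1)%N by lia.
  have -> : (2 * d + m.+1 = 2 * d + m + 1)%N by lia.
  by move=> E; rewrite binS -E; move: (\sum_(_ < m) _)%N 'C(_, d) => S C; lia.
rewrite sumE; last by lia.
rewrite /completions; have -> : (s == 0)%N = false by lia.
rewrite /= subSn // big_ord_recr /= addnC; congr addn.
Qed.

Section Words.
Variables (F : fieldType) (A : algType F) (u : nat -> A).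
Implicit Types (j k m : nat).

(** The block U_(k-1) ... U_j, which is empty for j at least k. *)
Fixpoint blk j k : A := if k is k'.+1 then if (j <= k')%N then u k' * blk j k' else 1 else 1.

(** Normal words in the first m generators: products of blocks U_i ... U_j whose
    starts i increase strictly and whose ends j increase strictly except that 0 may
    repeat. Each comes with the least end allowed for its next block. *)
Fixpoint nwords m : seq (A * nat) :=
  if m is k.+1 then
    nwords k ++ [seq (ws.1 * blk j k.+1, if j == 0%N then 0%N else j.+1)
                | ws <- nwords k, j <- iota ws.2 (k.+1 - ws.2)]
  else [:: (1, 0%N)].

Lemma nwords_bound m (w : A) (s : nat) : (w, s) \in nwords m -> (s <= m)%N.
Proof.
elim: m w s => [|m IH] w s /=; first by rewrite inE => /eqP[_ ->].
rewrite mem_cat => /orP[/IH/leqW//|/allpairsPdep[ws [j [_ ]]]].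
by rewrite mem_iota /= => Hj [_ ->]; case: eqP => // _; clear -Hj; lia.
Qed.

Lemma size_nwords m : size (nwords m) = 'C(2 * m, m).
Proof.
suff H d k : (\sum_(ws <- nwords k) completions d k ws.2 = \sum_(ws <- nwords (k + d)) 1)%N.
  by rewrite -sum1_size; have := H m 0%N; rewrite add0n => <-; rewrite big_seq1 /completions /= addn0.
elim: d k => [|d IH] k.
  by rewrite addn0; apply: eq_bigr => ws _; rewrite /completions bin0; case: eqP.
rewrite addnS -addSn -IH /= big_cat /= big_allpairs_dep /= -big_split /=.
rewrite big_seq [RHS]big_seq; apply: eq_bigr => -[w s] /nwords_bound sk.
exact: completionsS.
Qed.

End Words.

Section NormalWords.
Variables (F : fieldType) (A : algType F).
Variables (delta gamma beta : F) (n : nat) (u : nat -> A).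
Implicit Types (i j k l m : nat) (a x y : A) (c : F).

Local Notation blk := (blk u).
Local Notation nwords := (nwords u).

Hypothesis u_sq : forall i, (0 < i < n)%N -> u i * u i = delta *: u i.
Hypothesis u_sq0 : (0 < n)%N -> u 0%N * u 0%N = beta *: u 0%N.
Hypothesis u_TL : forall i j, (0 < i < n)%N -> (0 < j < n)%N -> i = j.+1 \/ j = i.+1 ->
  u i * u j * u i = u i.
Hypothesis u_comm : forall i j, (i < n)%N -> (j < n)%N -> (i.+1 < j)%N || (j.+1 < i)%N ->
  u i * u j = u j * u i.
Hypothesis u_101 : (1 < n)%N -> u 1%N * u 0%N * u 1%N = gamma *: u 1%N.

(** The subalgebra generated by the first k generators, built by right multiplication. *)
Inductive subalg k : A -> Prop :=
| sub1 : subalg k 1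
| subL c x y : subalg k x -> subalg k y -> subalg k (c *: x + y)
| subM x i : subalg k x -> (i < k)%N -> subalg k (x * u i).

Lemma sub0 k : subalg k 0.
Proof. by rewrite -(subrr 1) addrC -scaleN1r; apply: subL; apply: sub1. Qed.

Lemma subZ k c x : subalg k x -> subalg k (c *: x).
Proof. by move=> sx; rewrite -[_ *: x]addr0; apply: subL => //; apply: sub0. Qed.

Lemma sub_mul k x y : subalg k x -> subalg k y -> subalg k (x * y).
Proof.
move=> sx; elim=> {y}[|c y z _ IHy _ IHz|y i _ IH ik]; first by rewrite mulr1.
  by rewrite mulrDr -scalerAr; apply: subL.
by rewrite mulrA; apply: subM.
Qed.

Lemma sub_gen k i : (i < k)%N -> subalg k (u i).
Proof. by move=> ik; rewrite -[u i]mul1r; apply: subM => //; apply: sub1. Qed.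

Lemma sub_mono k l x : (k <= l)%N -> subalg k x -> subalg l x.
Proof.
move=> kl; elim=> {x}[|c x y _ IHx _ IHy|x i _ IH ik]; first exact: sub1.
  exact: subL.
by apply: subM => //; apply: leq_trans kl.
Qed.

Lemma sub_comm k l x : subalg k x -> (k < l)%N -> (l < n)%N -> x * u l = u l * x.
Proof.
move=> sx kl ln; elim: sx => {x}[|c x y _ IHx _ IHy|x i _ IH ik]; first by rewrite mulr1 mul1r.
  by rewrite mulrDl mulrDr -scalerAl -scalerAr IHx IHy.
by rewrite -mulrA (u_comm (i := i) (j := l)) ?mulrA ?IH //; lia.
Qed.

Lemma blkS j k : (j <= k)%N -> blk j k.+1 = u k * blk j k.
Proof. by move=> /= ->. Qed.

Lemma blk_nil j k : (k <= j)%N -> blk j k = 1.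
Proof. by case: k => //= k kj; rewrite leqNgt kj. Qed.

Lemma blk_cat i j k : (j <= i <= k)%N -> blk i k * blk j i = blk j k.
Proof.
elim: k => [|k IH] /andP[ji]; first by rewrite leqn0 => /eqP ->; rewrite mul1r.
rewrite leq_eqVlt => /orP[/eqP->|ik]; first by rewrite blk_nil // mul1r.
by rewrite !blkS ?(leq_trans ji) // -mulrA IH // ji.
Qed.

Lemma blk1 j : blk j j.+1 = u j.
Proof. by rewrite blkS // blk_nil // mulr1. Qed.

Lemma blk_last j k : (j < k)%N -> blk j k = blk j.+1 k * u j.
Proof. by move=> jk; rewrite -(blk1 j) blk_cat // leqnSn. Qed.

Lemma sub_blk j k : subalg k (blk j k).
Proof.
elim: k => [|k IH]; first exact: sub1.
rewrite /=; case: ifP => _; last exact: sub1.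
by apply: sub_mul; [apply: sub_gen | apply: sub_mono IH].
Qed.

Lemma blk_commute j k l : (l < n)%N -> (k <= n)%N -> (l.+1 < j)%N || (k < l)%N ->
  u l * blk j k = blk j k * u l.
Proof.
move=> ln; elim: k => [|k IH] kn H; first by rewrite mul1r mulr1.
rewrite /=; case: ifP => jk; last by rewrite mul1r mulr1.
rewrite mulrA (u_comm (i := l) (j := k)) //; last by lia.
by rewrite -!mulrA IH //; lia.
Qed.

Lemma sub_blk_commute m j k x : subalg m x -> (m < j)%N -> (k <= n)%N -> x * blk j k = blk j k * x.
Proof.
move=> sx mj; elim: k => [|k IH] kn; first by rewrite mul1r mulr1.
rewrite /=; case: ifP => jk; last by rewrite mul1r mulr1.
rewrite mulrA (sub_comm (l := k) sx) //; last by lia.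
by rewrite -!mulrA IH // ltnW.
Qed.

(** The sum over j of the spaces A_m U_m ... U_j, where A_m is generated by U_0, ...,
    U_(m-1); the value j = m+1 stands for A_m. *)
Inductive tails m : A -> Prop :=
| tails0 : tails m 0
| tailsD a j y : subalg m a -> (j <= m.+1)%N -> tails m y -> tails m (a * blk j m.+1 + y).

Lemma tails_blk m a j : subalg m a -> (j <= m.+1)%N -> tails m (a * blk j m.+1).
Proof. by move=> sa jm; rewrite -[_ * _]addr0; apply: tailsD => //; apply: tails0. Qed.

Lemma tails_lin m c x y : tails m x -> tails m y -> tails m (c *: x + y).
Proof.
move=> tx ty; elim: tx => [|a j z sa jm _ IH]; first by rewrite scaler0 add0r.
by rewrite scalerDr -addrA scalerAl; apply: tailsD => //; apply: subZ.
Qed.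

(** Multiplying U_m ... U_j on the right by U_i lengthens the block, gives back a
    multiple of it, or, by the relations, frees a left factor in A_m. *)
Lemma tails_mul m a j i : (m < n)%N -> subalg m a -> (j <= m.+1)%N -> (i <= m)%N ->
  tails m (a * blk j m.+1 * u i).
Proof.
move=> mn sa; rewrite leq_eqVlt => /orP[/eqP->|].
  rewrite blk_nil // mulr1 leq_eqVlt => /orP[/eqP->|im].
    by rewrite -(blk1 m); apply: tails_blk.
  by rewrite -[_ * _]mulr1 -(blk_nil (leqnn m.+1)); apply: tails_blk => //; apply: subM.
rewrite ltnS => jm im.
have [ij|ji] := ltnP i j.
  have [ij'|ij'] := eqVneq j i.+1.
    by rewrite -mulrA ij' -blk_last ?ltnS //; apply: tails_blk => //; lia.
  rewrite -mulrA -blk_commute //; try lia.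
  by rewrite mulrA; apply: tails_blk; [apply: subM => //; lia | lia].
move: ji; rewrite leq_eqVlt => /orP[/eqP <-|ji].
  rewrite blk_last // -!mulrA.
  (* The square of U_j is beta U_0 or delta U_j; only its being a multiple matters. *)
have [c ->] : exists c, u j * u j = c *: u j.
    by have [->|j0] := posnP j; [exists beta; apply: u_sq0; lia | exists delta; apply: u_sq; lia].
  by rewrite -!scalerAr -blk_last // scalerAl; apply: tails_blk; [apply: subZ | lia].
(* For j < i the block contains U_i U_(i-1), and U_i on the right commutes up to these two letters. *)
have -> : blk j m.+1 = blk i.+1 m.+1 * u i * (u i.-1 * blk j i.-1).
  by rewrite -blk_last ?ltnS // -blkS ?prednK ?blk_cat //; lia.
rewrite -!mulrA -(blk_commute (l := i)) //; try lia.
rewrite [u i.-1 * _]mulrA [u i * _]mulrA [u i * (_ * _)]mulrA.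
have [i1|i1] := eqVneq i 1%N.
  rewrite i1 -[(1.-1)%N]/0%N u_101; last by lia.
  rewrite [blk j 0]/= mulr1 -scalerAr -blk_last; last by lia.
  by rewrite -scalerAr scalerAl; apply: tails_blk; [apply: subZ | lia].
rewrite u_TL; try lia.
rewrite [blk i.+1 _ * _]mulrA -blk_last; last by lia.
rewrite -(sub_blk_commute (m := i.-1)) //; [|exact: sub_blk|lia].
rewrite mulrA; apply: tails_blk; last by lia.
by apply: sub_mul => //; apply: sub_mono (sub_blk _ _); lia.
Qed.

Lemma sub_tails m x : (m < n)%N -> subalg m.+1 x -> tails m x.
Proof.
move=> mn; elim=> {x}[|c x y _ IHx _ IHy|x i _ IH im].
- by rewrite -[1]mulr1 -{2}(blk_nil (leqnn m.+1)); apply: tails_blk => //; apply: sub1.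
- exact: tails_lin.
- elim: IH => [|a j y sa jm _ IH]; first by rewrite mul0r; apply: tails0.
  by rewrite mulrDl -[_ * _]scale1r; apply: tails_lin => //; apply: tails_mul.
Qed.

Inductive lspan (s : seq A) : A -> Prop :=
| lspan0 : lspan s 0
| lspanD c x y : x \in s -> lspan s y -> lspan s (c *: x + y).

Lemma lspan_mem s x : x \in s -> lspan s x.
Proof. by move=> xs; rewrite -[x]addr0 -[x]scale1r; apply: lspanD => //; apply: lspan0. Qed.

Lemma lspan_lin s c x y : lspan s x -> lspan s y -> lspan s (c *: x + y).
Proof.
move=> sx sy; elim: sx => [|d z w zs _ IH]; first by rewrite scaler0 add0r.
by rewrite scalerDr -addrA scalerA; apply: lspanD.
Qed.

Lemma mem_nwords m (w : A) (s : nat) : (w, s) \in nwords m ->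
  [/\ subalg m w, (s <= m)%N & (0 < s)%N -> exists w' j k,
     [/\ w = w' * blk j k, subalg m w', s = j.+1 & (0 < j < k)%N && (k <= m)%N]].
Proof.
elim: m w s => [|m IH] w s /=.
  by rewrite inE => /eqP[-> ->]; split=> //; apply: sub1.
rewrite mem_cat => /orP[/IH[sw sm H]|/allpairsPdep[[w' s'] [j [/IH[sw' sm _]]]]].
  split; [exact: sub_mono sw | exact: leqW |].
  move=> /H[w' [j [k [E sw' Es jk]]]]; exists w', j, k; split=> //; last by lia.
  exact: sub_mono sw'.
rewrite mem_iota /= => Hj [-> ->].
have sw'' : subalg m.+1 w' by apply: sub_mono sw'.
split; first by apply: sub_mul => //; apply: sub_blk.
  by case: eqP => // _; lia.
case: eqP => // /eqP j0 _; exists w', j, m.+1; split=> //; lia.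
Qed.

(** It suffices to bring w U_m ... U_j to normal form for a normal word w in the lower
    generators. If the last block of w ends with l at least j, then U_l meets
    U_(l+1) U_l inside the new block, and U_l U_(l+1) U_l = U_l leaves a shorter block
    U_m ... U_(l+2), with all the rest moved into A_m; repeat with this larger end. *)
Lemma lspan_words m x : (m <= n)%N -> subalg m x -> lspan [seq ws.1 | ws <- nwords m] x.
Proof.
elim: m x => [|m IH] x mn sx.
  elim: sx => {x}[|c x y _ IHx _ IHy|//]; first by apply: lspan_mem; rewrite inE.
  exact: lspan_lin.
elim: (sub_tails mn sx) => {x sx}[|a j y sa jm _ IHy]; first exact: lspan0.
rewrite -[_ * _]scale1r; apply: lspan_lin => {y IHy}//.
(* Induction on the length of the last block. *)
have [d] := ubnP (m.+1 - j); elim: d j a sa jm => // d IHd j a sa jm; rewrite ltnS => jd.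
elim: (IH a (ltnW mn) sa) => [|c w y /mapP[[w' s] wn ->] _ IHy]; first by rewrite mul0r; apply: lspan0.
rewrite mulrDl -scalerAl [(w', s).1]/=; apply: lspan_lin => {y IHy w}//.
have [sw sm Hs] := mem_nwords wn.
move: jm; rewrite leq_eqVlt => /orP[/eqP->|jm].
  rewrite (blk_nil (leqnn m.+1)) mulr1; apply: lspan_mem; apply/mapP; exists (w', s) => //=.
  by rewrite mem_cat wn.
have [sj|js] := leqP s j.
  apply: lspan_mem; apply/mapP; exists (w' * blk j m.+1, if j == 0%N then 0%N else j.+1) => //.
  rewrite [nwords _]/= mem_cat; apply/orP; right; apply/allpairsPdep.
  by exists (w', s), j; split=> //=; rewrite mem_iota /=; lia.
have s0 : (0 < s)%N by lia.
have [w [l [k [E sw1 sE /andP[/andP[l0 lk] km]]]]] := Hs s0.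
have -> : w' * blk j m.+1 = (w * (blk l.+1 k * blk j l.+1)) * blk l.+2 m.+1.
  rewrite E (blk_last lk) -!mulrA; congr (_ * (_ * _)).
  have [jl lm] : (j <= l)%N /\ (l < m)%N by split; lia.
  rewrite -(blk_cat (i := l.+1) (j := j) (k := m.+1)); last by lia.
  rewrite -(blk_cat (i := l) (j := j) (k := l.+1)); last by lia.
  rewrite (blk_last (j := l.+1)) ?ltnS // blk1.
  rewrite -!mulrA [u l * (blk _ _ * _)]mulrA blk_commute; try lia.
  rewrite -!mulrA [u l * (u _ * _)]mulrA [u l * u l.+1 * _]mulrA u_TL; try lia.
  rewrite -(sub_blk_commute (m := l.+1)) //; try lia; last first.
    by apply: sub_mul; [apply: sub_gen | apply: sub_mono (sub_blk _ _)].
  by rewrite mulrA.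
apply: IHd; try lia.
apply: sub_mul => //; apply: sub_mul; apply: sub_mono (sub_blk _ _) => //; lia.
Qed.

End NormalWords.
(** * The presented algebra acts on the diagram space *)

Section FreeAlgebra.
Variables (F : fieldType) (n : nat).
Implicit Types (x y : free_alg F n) (k : {fmonom 'I_n}) (P : free_alg F n -> Prop).

Lemma malg_ind P : P 0 -> (forall c x y, P x -> P y -> P (c *: x + y)) ->
  (forall k, P << k >>) -> forall x, P x.
Proof.
move=> P0 PL Pk x.
rewrite (monalgE x); elim: (enum_fset (msupp x)) => [|k s IH]; first by rewrite big_nil.
rewrite big_cons; suff -> : << x@_k *g k >> = x@_k *: (<< k >> : free_alg F n) by apply: PL.
apply/malgP => l; rewrite [RHS]mcoeffZ [LHS]mcoeffU mcoeffU1 mulr_natr.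
by case: eqP.
Qed.

Lemma free_gen_monomial i (s : seq 'I_n) :
  free_gen F i * << FMonom s >> = << FMonom (i :: s) >>.
Proof. by rewrite [LHS]fgmulUU mulr1; congr << _ >>; rewrite [LHS]fmmulE fmuE. Qed.

(** The free algebra is spanned by words, and words are built by left multiplication. *)
Lemma free_ind P : P 1 -> (forall c x y, P x -> P y -> P (c *: x + y)) ->
  (forall i x, P x -> P (free_gen F i * x)) -> forall x, P x.
Proof.
move=> P1 PL PM; apply: malg_ind => // [|[s]].
  by rewrite -(subrr 1) addrC -scaleN1r; apply: PL.
elim: s => [|i s IH]; first by rewrite -fmoneE.
by rewrite -free_gen_monomial; apply: PM.
Qed.

End FreeAlgebra.

Section DiagramSpace.
Variables (F : fieldType) (n : nat).
Local Notation V := (nil_blob_diag F n).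
Implicit Types (D : blob n) (v w : V).

Lemma diag_basisE D D' : diag_basis F D D' = (D' == D)%:R.
Proof. by rewrite ffunE. Qed.

Lemma diag_expand v : v = \sum_D v D *: diag_basis F D.
Proof.
apply/ffunP => D; rewrite sum_ffunE (bigD1 D) //= big1 ?addr0.
  by rewrite !ffunE eqxx; apply/esym/mulr1.
by move=> D' neq; rewrite !ffunE eq_sym (negbTE neq); apply: mulr0.
Qed.

Lemma diag_linear_ext (W : lmodType F) (f g : V -> W) : linear f -> linear g ->
  (forall D, f (diag_basis F D) = g (diag_basis F D)) -> f =1 g.
Proof.
move=> lf lg E v.
pose f' : {linear V -> W} := HB.pack f (GRing.isLinear.Build _ _ _ _ f lf).
pose g' : {linear V -> W} := HB.pack g (GRing.isLinear.Build _ _ _ _ g lg).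
rewrite -[f v]/(f' v) -[g v]/(g' v) (diag_expand v) !linear_sum.
by apply: eq_bigr => D _; rewrite !linearZ /= E.
Qed.

Definition diag_map (f : blob n -> V) v : V := \sum_D v D *: f D.

Lemma diag_map_linear f : linear (diag_map f).
Proof.
move=> c v w; rewrite /diag_map scaler_sumr -big_split /=; apply: eq_bigr => D _.
by rewrite !ffunE scalerDl scalerA.
Qed.

Lemma diag_map_basis f D : diag_map f (diag_basis F D) = f D.
Proof.
rewrite /diag_map (bigD1 D) //= big1 ?addr0; first by rewrite diag_basisE eqxx scale1r.
by move=> D' neq; rewrite diag_basisE (negbTE neq) scale0r.
Qed.

Lemma diag_mul_linearl v : linear (fun a => diag_mul a v).
Proof.
move=> c a b; rewrite /diag_mul scaler_sumr -big_split /=; apply: eq_bigr => D _.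
rewrite scaler_sumr -big_split /=; apply: eq_bigr => D' _.
by rewrite !ffunE scalerA -scalerDl mulrDl mulrA.
Qed.

Lemma diag_mul_linearr v : linear (fun a => diag_mul v a).
Proof.
move=> c a b; rewrite /diag_mul scaler_sumr -big_split /=; apply: eq_bigr => D _.
rewrite scaler_sumr -big_split /=; apply: eq_bigr => D' _.
by rewrite !ffunE scalerA -scalerDl mulrDr [c * _]mulrCA.
Qed.

Lemma diag_mul_basis D D' : diag_mul (diag_basis F D) (diag_basis F D') = diag_prod F D D'.
Proof.
have -> : diag_mul (diag_basis F D) (diag_basis F D') =
   diag_map (fun D1 => diag_map (fun D2 => diag_prod F D1 D2) (diag_basis F D')) (diag_basis F D).
  apply: eq_bigr => D1 _; rewrite scaler_sumr; apply: eq_bigr => D2 _; by rewrite scalerA.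
by rewrite !diag_map_basis.
Qed.

End DiagramSpace.

Section Representation.
Variables (F : fieldType) (delta gamma beta : F) (n : nat).
Local Notation V := (nil_blob_diag F n).
Local Notation gen_weight := (gen_weight delta gamma beta).
Implicit Types (D : blob n) (v w : V) (i j : 'I_n) (x y : free_alg F n).

Definition diag_act i : V -> V := diag_map (fun D => gen_weight i (val D) *: diag_basis F (blob_act i D)).

Lemma diag_act_linear i : linear (diag_act i).
Proof. exact: diag_map_linear. Qed.

HB.instance Definition _ i := GRing.isLinear.Build F V V _ (diag_act i) (diag_act_linear i).

Lemma diag_act_basis i D : diag_act i (diag_basis F D) = gen_weight i (val D) *: diag_basis F (blob_act i D).
Proof. exact: diag_map_basis. Qed.

Lemma diag_actZ i c v : diag_act i (c *: v) = c *: diag_act i v.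
Proof. exact: linearZ. Qed.

Definition word_act (s : seq 'I_n) v : V := foldr diag_act v s.

Definition free_act x v : V :=
  [ffun D => mmap idfun (fun k : {fmonom 'I_n} => word_act k v D : F) x].

Lemma free_act_linear v : linear (free_act^~ v).
Proof.
move=> c x y; apply/ffunP => D; rewrite !ffunE mmapD; congr (_ + _).
rewrite (mmapEw (msuppZ_le _ _)) mmapE [RHS]big_distrr /=.
by apply: eq_bigr => k _; rewrite mcoeffZ mulrA.
Qed.

Lemma free_act0 v : free_act 0 v = 0.
Proof. by apply/ffunP => D; rewrite !ffunE mmap0. Qed.

Lemma free_actU (k : {fmonom 'I_n}) v : free_act << k >> v = word_act k v.
Proof. by apply/ffunP => D; rewrite ffunE mmapU mul1r. Qed.

Lemma free_act1 v : free_act 1 v = v.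
Proof. by rewrite free_actU fm1. Qed.

Lemma free_actM i x v : free_act (free_gen F i * x) v = diag_act i (free_act x v).
Proof.
elim/malg_ind: x => [|c x y IHx IHy|[s]].
- by rewrite mulr0 free_act0 linear0.
- rewrite mulrDr.
  rewrite -free_scaleAr.
  rewrite free_act_linear.
  rewrite free_act_linear.
  by rewrite diag_act_linear; congr (_ *: _ + _); [exact: IHx | exact: IHy].
- by rewrite free_gen_monomial !free_actU.
Qed.

End Representation.

Lemma lspan_coord (F : fieldType) (A : algType F) (s : seq A) (a : A) : lspan s a ->
  exists c : 'rV[F]_(size s), a = \sum_i c 0 i *: s`_i.
Proof.
elim=> [|c x y xs _ [d ->]].
  by exists 0; rewrite big1 // => i _; rewrite mxE scale0r.
rewrite -index_mem in xs; exists (c *: delta_mx 0 (Ordinal xs) + d).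
rewrite -[in LHS](nth_index 0 (_ : x \in s)) -?index_mem //.
transitivity (\sum_i (c *: delta_mx 0 (Ordinal xs) : 'rV_(size s)) 0 i *: s`_i + \sum_i d 0 i *: s`_i).
  congr (_ + _); rewrite (bigD1 (Ordinal xs)) //= big1 ?addr0.
    by rewrite !mxE !eqxx mulr1.
  by move=> i /negbTE ni; rewrite !mxE ni andbF mulr0 scale0r.
by rewrite -big_split /=; apply: eq_bigr => i _; rewrite [in RHS]mxE scalerDl.
Qed.

(** The matrix of the images of s has full row space, hence rank #|I|; it has at most
    #|I| rows, so it is invertible. *)
Lemma spanned_onto_bij (F : fieldType) (A : algType F) (I : finType)
  (f : {linear A -> {ffun I -> F^o}}) (s : seq A) :
  (forall a, lspan s a) -> (forall v, exists a, f a = v) -> (size s <= #|I|)%N ->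
  bijective f /\ #|I| = size s.
Proof.
move=> span surj sI.
pose M : 'M[F]_(size s, #|I|) := \matrix_(i, j) f s`_i (enum_val j).
have fM (c : 'rV_(size s)) j : f (\sum_i c 0 i *: s`_i) (enum_val j) = (c *m M) 0 j.
  rewrite linear_sum sum_ffunE !mxE; apply: eq_bigr => i _.
  by rewrite linearZ_LR ffunE mxE.
(* Surjectivity of f puts each unit vector in the row space. *)
have full : row_full M.
  rewrite -sub1mx; apply/row_subP => j.
  have [a aE] := surj [ffun x => (x == enum_val j)%:R]; have [c cE] := lspan_coord (span a).
  apply/submxP; exists c; apply/rowP => k; rewrite -fM -cE aE ffunE !mxE.
  by rewrite (inj_eq enum_val_inj) eq_sym.
have cardE : #|I| = size s.
  apply/eqP; rewrite eqn_leq sI andbT; apply: leq_trans (rank_leq_row M).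
  by rewrite (eqP full).
have free : row_free M by rewrite /row_free (eqP full) cardE.
have ker0 a : f a = 0 -> a = 0.
  have [c ->] := lspan_coord (span a) => f0.
  have : c *m M == 0 by apply/eqP/rowP => j; rewrite -fM f0 ffunE mxE.
  by rewrite mulmx_free_eq0 // => /eqP ->; rewrite big1 // => i _; rewrite mxE scale0r.
split=> //.
have surj' v : exists a, f a == v by have [a <-] := surj v; exists a.
exists (fun v => xchoose (surj' v)) => [a|v]; last exact/eqP/(xchooseP (surj' v)).
apply/eqP; rewrite -subr_eq0; apply/eqP/ker0.
by rewrite linearB /= (eqP (xchooseP (surj' (f a)))) subrr.
Qed.

Lemma bij_has_dim (F : fieldType) (A : lmodType F) (I : finType)
  (f : {linear A -> {ffun I -> F^o}}) d : bijective f -> #|I| = d -> has_dim A d.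
Proof.
case=> g fK gK <-; constructor.
exists (fun a => \row_j f a (enum_val j)).
  by move=> c a b; apply/rowP => j; rewrite !mxE linearP !ffunE.
exists (fun r : 'rV_ _ => g [ffun x => r 0 (enum_rank x)]) => [a|r].
  rewrite -[RHS]fK; congr g; apply/ffunP => x; by rewrite ffunE mxE enum_rankK.
by apply/rowP => j; rewrite mxE gK ffunE enum_valK.
Qed.

Section Presented.
Variables (F : fieldType) (delta gamma beta : F) (n : nat).
Variables (B : lalgType F) (g : 'I_n -> B).
Local Notation V := (nil_blob_diag F n).
Local Notation diag_act := (diag_act delta gamma beta).
(** B stands for the free algebra and g for its generators. *)
Hypothesis B_ind : forall P : B -> Prop, P 1 ->
  (forall c x y, P x -> P y -> P (c *: x + y)) ->
  (forall i x, P x -> P (g i * x)) -> forall x, P x.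
Variable bact : B -> V -> V.
Hypothesis bact_lin : forall v, linear (bact^~ v).
Hypothesis bact1 : forall v, bact 1 v = v.
Hypothesis bactM : forall i x v, bact (g i * x) v = diag_act i (bact x v).
Implicit Types (D : blob n) (v w : V) (i j : 'I_n) (x y : B).

Lemma bact0 v : bact 0 v = 0.
Proof. by rewrite -[0](subrr 1) addrC -scaleN1r bact_lin scaleN1r addNr. Qed.

Lemma bact_gen i v : bact (g i) v = diag_act i v.
Proof. by rewrite -[g i]mulr1 bactM bact1. Qed.

Lemma bact_mul x y v : bact (x * y) v = bact x (bact y v).
Proof.
elim/B_ind: x => [|c x z IHx IHz|i x IH].
- rewrite mul1r.
  by rewrite bact1.
- rewrite mulrDl.
  rewrite -scalerAl.
  rewrite !bact_lin.
  rewrite IHx.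
  by rewrite IHz.
- rewrite -mulrA.
  rewrite !bactM.
  by rewrite IH.
Qed.

Lemma bact_linearr x : linear (bact x).
Proof.
move=> c v w; elim/B_ind: x => [|d x y IHx IHy|i x IH]; first by rewrite !bact1.
  rewrite !bact_lin IHx IHy !scalerDr !scalerA [d * c]mulrC -!addrA.
  by congr (_ + _); rewrite addrCA.
by rewrite !bactM IH linearP.
Qed.

(** The relations common to the nil-blob and the blob algebra. *)
Inductive blob_presentation : B -> B -> Prop :=
| bp_sq i : i != 0%N :> nat ->
    blob_presentation (g i * g i) (delta *: g i)
| bp_TL i j : i != 0%N :> nat -> j != 0%N :> nat -> i = j.+1 :> nat \/ j = i.+1 :> nat ->
    blob_presentation (g i * g j * g i) (g i)
| bp_comm i j : (i.+1 < j)%N || (j.+1 < i)%N ->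
    blob_presentation (g i * g j) (g j * g i)
| bp_101 i j : i = 1%N :> nat -> j = 0%N :> nat ->
    blob_presentation (g i * g j * g i) (gamma *: g i)
| bp_sq0 i : i = 0%N :> nat ->
    blob_presentation (g i * g i) (beta *: g i).

Lemma bact_scale c x v : bact (c *: x) v = c *: bact x v.
Proof. by rewrite -[c *: x]addr0 bact_lin bact0 addr0. Qed.

Lemma blob_presentation_act x y : blob_presentation x y -> forall v, bact x v = bact y v.
Proof.
move=> xy; apply: diag_linear_ext; try exact: bact_linearr.
have actE i D : val (blob_act i D) = gen i (val D) by [].
case: xy => [i i0|i j i0 j0 ij|i j ij|i j i1 j0|i i0] D;
  rewrite ?bact_scale ?bact_mul !bact_gen !(diag_act_basis, diag_actZ) ?scalerA ?actE.
- have [E ->] := gen_sq delta gamma beta i0 (blob_wf D); rewrite mulrC; congr (_ *: diag_basis _ _).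
  exact: val_inj.
- have [E -> ->] := gen_TL delta gamma beta i0 j0 ij (blob_wf D); rewrite !mulr1.
  by congr (_ *: diag_basis _ _); apply: val_inj.
- have [E ->] := gen_comm delta gamma beta ij (blob_wf D).
  by congr (_ *: diag_basis _ _); apply: val_inj.
- have [E -> ->] := gen_101 delta gamma beta i1 j0 (blob_wf D); rewrite mulr1 mulrC.
  by congr (_ *: diag_basis _ _); apply: val_inj.
- have [E ->] := gen_sq0 delta gamma beta i0 (blob_wf D); rewrite mulrC.
  by congr (_ *: diag_basis _ _); apply: val_inj.
Qed.

Variables (A : algType F) (pr : B -> A) (sec : A -> B).
(** The map pr is the projection of the free algebra to the presented one, and sec a
    set-theoretic section of it. *)
Hypothesis pr_lin : linear pr.
Hypothesis pr_mul : {morph pr : x y / x * y}.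
Hypothesis pr1 : pr 1 = 1.
Hypothesis secK : cancel sec pr.
Hypothesis pr_rel : forall x y, blob_presentation x y -> pr x = pr y.
Hypothesis pr_ker : forall x y, pr x = pr y -> forall v : V, bact x v = bact y v.
Implicit Types (a b : A).

Definition rep a v : V := bact (sec a) v.
(** The value of a at the diagram of vertical lines, which is the isomorphism sought. *)
Definition at_identity a : V := rep a (diag_basis F (line_diag n)).

Lemma rep_pr x v : rep (pr x) v = bact x v.
Proof. by apply: pr_ker; rewrite secK. Qed.

Lemma rep_linear v : linear (rep^~ v).
Proof.
by move=> c a b; rewrite -(secK a) -(secK b) -pr_lin !rep_pr bact_lin.
Qed.

Lemma rep_mul a b v : rep (a * b) v = rep a (rep b v).
Proof. by rewrite -(secK a) -(secK b) -pr_mul !rep_pr bact_mul. Qed.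

Lemma rep1 v : rep 1 v = v.
Proof. by rewrite -pr1 rep_pr bact1. Qed.

Lemma rep_gen i v : rep (pr (g i)) v = diag_act i v.
Proof. by rewrite rep_pr bact_gen. Qed.

Lemma at_identity_linear : linear at_identity.
Proof. exact: rep_linear. Qed.

Lemma at_identity_gen i a : at_identity (pr (g i) * a) = diag_act i (at_identity a).
Proof. by rewrite /at_identity rep_mul rep_gen. Qed.

Lemma at_identity1 : at_identity 1 = diag_basis F (line_diag n).
Proof. exact: rep1. Qed.

(** A reduced factorization of a diagram lifts it to a product of generators. *)
Lemma at_identity_onto v : exists a, at_identity a = v.
Proof.
suff H D : exists a, at_identity a = diag_basis F D.
  have [h hE] : exists h : blob n -> A, forall D, at_identity (h D) = diag_basis F D.
    have H' D : exists a, at_identity a == diag_basis F D by have [a E] := H D; exists a; rewrite E.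
    by exists (fun D => xchoose (H' D)) => D; apply/eqP/(xchooseP (H' D)).
  pose f : {linear A -> V} :=
    HB.pack at_identity (GRing.isLinear.Build _ _ _ _ at_identity at_identity_linear).
  exists (\sum_D v D *: h D); rewrite -[at_identity _]/(f _) linear_sum [RHS]diag_expand.
  by apply: eq_bigr => D _; rewrite linearZ_LR -[f _]/(at_identity _) hE.
elim/blob_gen_ind: D => [|i D w [a aE]]; first by exists 1; apply: at_identity1.
exists (pr (g i) * a).
rewrite at_identity_gen.
rewrite aE.
rewrite diag_act_basis.
rewrite w.
exact: scale1r.
Qed.

(** The generators as a sequence indexed by all natural numbers, as the normal words
    require. *)
Definition pgen k : A := if insub k is Some i then pr (g (i : 'I_n)) else 0.

Lemma pgenE (i : 'I_n) : pgen i = pr (g i).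
Proof. by rewrite /pgen valK. Qed.

Lemma pgen_sub a : subalg pgen n a.
Proof.
rewrite -(secK a); elim/B_ind: (sec a) => [|c x y IHx IHy|i x IH].
- by rewrite pr1; apply: sub1.
- by rewrite pr_lin; apply: subL.
- by rewrite pr_mul -pgenE; apply: sub_mul => //; apply: sub_gen.
Qed.

Lemma prZ c x : pr (c *: x) = c *: pr x.
Proof.
have pr0 : pr 0 = 0 by rewrite -[0](subrr 1) addrC -scaleN1r pr_lin pr1 scaleN1r addNr.
by rewrite -[c *: x]addr0 pr_lin pr0 addr0.
Qed.

Lemma pgen_span a : lspan [seq ws.1 | ws <- nwords pgen n] a.
Proof.
have gE k (kn : (k < n)%N) : pgen k = pr (g (Ordinal kn)).
  by rewrite -pgenE.
apply: (@lspan_words _ _ delta gamma beta n) (leqnn n) (pgen_sub a).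
- move=> i /andP[i0 lt]; rewrite !(gE _ lt) -pr_mul -prZ; apply/pr_rel/bp_sq.
  by rewrite -lt0n.
- by move=> n0; rewrite !(gE _ n0) -pr_mul -prZ; apply/pr_rel/bp_sq0.
- move=> i j /andP[i0 lti] /andP[j0 ltj] ij; rewrite !(gE _ lti) !(gE _ ltj) -!pr_mul.
  by apply/pr_rel/bp_TL => //=; rewrite -lt0n.
- move=> i j lti ltj ij; rewrite !(gE _ lti) !(gE _ ltj) -!pr_mul.
  exact/pr_rel/bp_comm.
- move=> n1; have n0 : (0 < n)%N by apply: ltnW.
  by rewrite !(gE _ n1) !(gE _ n0) -!pr_mul -prZ; apply/pr_rel/bp_101.
Qed.

Lemma presented_iso : exists f : {linear A -> V},
  [/\ bijective f, f 1 = diag_basis F (line_diag n)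
    & forall i a, f (pr (g i) * a) = diag_act i (f a)] /\
  #|{: blob n}| = 'C(2 * n, n).
Proof.
pose f : {linear A -> V} :=
  HB.pack at_identity (GRing.isLinear.Build _ _ _ _ at_identity at_identity_linear).
exists f.
have [] := @spanned_onto_bij F A (blob n) f [seq ws.1 | ws <- nwords pgen n].
- exact: pgen_span.
- exact: at_identity_onto.
- by rewrite size_map size_nwords card_blob_ge.
rewrite size_map size_nwords => bij card; split=> //; split=> //.
- exact: at_identity1.
- exact: at_identity_gen.
Qed.

End Presented.
(** * The product of diagrams and the two presentations *)

Section NilMultiplication.
Variables (F : fieldType) (n : nat).
Local Notation V := (nil_blob_diag F n).
Local Notation delta := (- 2%:R : F).
Local Notation nil_act := (diag_act delta 0 0).
Implicit Types (v w : V) (D : blob n).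

(** A factorization of D1 reduces the general case to the diagram of vertical lines. *)
Lemma blob_concat D1 D2 : exists c D, concat delta D1 D2 c D.
Proof.
elim/blob_gen_ind: D1 => [|i D1 _ [c [D H]]]; first by exists 1, D2; apply: concat_line.
by have [c' H' _] := concat_blob_act i H; exists c', (blob_act i D).
Qed.

Lemma diag_mul_line w : diag_mul (diag_basis F (line_diag n)) w = w.
Proof.
move: w; apply: diag_linear_ext => [||D]; first exact: diag_mul_linearr.
  by [].
rewrite diag_mul_basis (diag_prodE (concat_line delta D)) //; exact: scale1r.
Qed.

Lemma diag_mul_act i v w : diag_mul (nil_act i v) w = nil_act i (diag_mul v w).
Proof.
have mulZ c a b : diag_mul (c *: a) b = c *: diag_mul a b :> V.
  pose f : {linear V -> V} := HB.pack (fun a : V => diag_mul a b)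
    (GRing.isLinear.Build _ _ _ _ (fun a : V => diag_mul a b) (diag_mul_linearl b)).
  exact: (linearZ_LR f).
move: v; apply: diag_linear_ext => [c x y|c x y|D1].
- by rewrite diag_act_linear diag_mul_linearl.
- by rewrite diag_mul_linearl diag_act_linear.
move: w; apply: diag_linear_ext => [c x y|c x y|D2].
- by rewrite diag_mul_linearr.
- by rewrite diag_mul_linearr diag_act_linear.
have [c [D H]] := blob_concat D1 D2; have [c' H' w] := concat_blob_act i H.
have prodE := etrans (diag_mul_basis F D1 D2) (diag_prodE H erefl).
have prodE' := etrans (diag_mul_basis F (blob_act i D1) D2) (diag_prodE H' erefl).
apply: etrans (congr1 (@diag_mul F n ^~ _) (diag_act_basis delta 0 0 i D1)) _.
apply: etrans (mulZ _ _ _) _; apply: etrans (congr1 ( *:%R _) prodE') _.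
apply: esym; apply: etrans (congr1 (nil_act i) prodE) _.
apply: etrans (diag_actZ _ _ _ _ _ _) _.
apply: etrans (congr1 ( *:%R _) (diag_act_basis delta 0 0 i D)) _.
apply: etrans (scalerA _ _ _) _; apply: esym; apply: etrans (scalerA _ _ _) _.
exact: (congr1 ( *:%R^~ _) (etrans w (mulrC _ _))).
Qed.

End NilMultiplication.

Lemma free_actB (F : fieldType) (delta gamma beta : F) n (x y : free_alg F n) v :
  free_act delta gamma beta (x - y) v =
  free_act delta gamma beta x v - free_act delta gamma beta y v.
Proof.
rewrite -[- y]scaleN1r [x + _]addrC [LHS](free_act_linear delta gamma beta).
by rewrite scaleN1r addrC.
Qed.

Section PresentedBlob.
Variables (F : fieldType) (delta gamma beta : F) (n : nat).
Variable rel : free_alg F n -> free_alg F n -> Prop.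
Hypothesis relE : forall x y, rel x y <-> blob_presentation delta gamma beta (@free_gen F n) x y.
Local Notation V := (nil_blob_diag F n).
Local Notation fact := (@free_act F delta gamma beta n).

(** The elements acting by zero form an ideal that contains the relations. *)
Lemma gen_ideal_act z : gen_ideal rel z -> forall v : V, fact z v = 0.
Proof.
have lin v : linear (fact^~ v) by exact: free_act_linear.
have fM x y v : fact (x * y) v = fact x (fact y v).
  by apply: (bact_mul (@free_ind F n)); [exact: free_act_linear | exact: free_act1 | exact: free_actM].
have f0 x : fact x 0 = 0.
  have linr := bact_linearr (@free_ind F n) (@free_act_linear F delta gamma beta n)
    (@free_act1 F delta gamma beta n) (@free_actM F delta gamma beta n) x.
  by have := linr (-1) 0 0; rewrite scaler0 addr0 scaleN1r addNr.
elim=> {z}[x y /relE xy||x y _ IHx _ IHy|a x _ IH|a x _ IH] v.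
- rewrite free_actB (blob_presentation_act (@free_ind F n) (@free_act_linear F delta gamma beta n)
    (@free_act1 F delta gamma beta n) (@free_actM F delta gamma beta n) xy).
  by rewrite subrr.
- exact: free_act0.
- by rewrite -[x]scale1r lin IHx IHy scaler0 addr0.
- by rewrite fM IH f0.
- by rewrite fM IH.
Qed.

Lemma pres_pi_ker x y : pres_pi rel x = pres_pi rel y -> forall v : V, fact x v = fact y v.
Proof.
move/pres_piE/gen_ideal_act => H v; apply/eqP; by rewrite -subr_eq0 -free_actB H.
Qed.

Lemma pres_pi_rel x y : blob_presentation delta gamma beta (@free_gen F n) x y -> pres_pi rel x = pres_pi rel y.
Proof. by move=> xy; apply/pres_piE/gen_ideal_rel/relE. Qed.
End PresentedBlob.

Section Instances.
Variables (F : fieldType) (n : nat).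

Lemma nil_blob_relE x y : @nil_blob_rel F n x y <-> blob_presentation (- 2%:R) 0 0 (@free_gen F n) x y.
Proof.
split=> [[i i0|i j i0 j0 ij|i j ij|i j i1 j0|i i0]|[i i0|i j i0 j0 ij|i j ij|i j i1 j0|i i0]].
- by apply: bp_sq; rewrite -lt0n.
- by apply: bp_TL; rewrite -?lt0n //; lia.
- by apply: bp_comm; lia.
- by rewrite -(scale0r (free_gen F i)); apply: bp_101.
- by rewrite -(scale0r (free_gen F i)); apply: bp_sq0.
- by apply: nil_blob_sq; rewrite lt0n.
- by apply: nil_blob_TL; rewrite ?lt0n //; lia.
- by apply: nil_blob_comm; lia.
- by rewrite scale0r; apply: nil_blob_101.
- by rewrite scale0r; apply: nil_blob_sq0.
Qed.

Lemma blob_relE q m x y : @blob_rel F n q m x y <->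
  blob_presentation (- qint q 2) (qint q (m - 1)) (- qint q m) (@free_gen F n) x y.
Proof.
split=> [[i i0|i j i0 j0 ij|i j ij|i j i1 j0|i i0]|[i i0|i j i0 j0 ij|i j ij|i j i1 j0|i i0]].
- by apply: bp_sq; rewrite -lt0n.
- by apply: bp_TL; rewrite -?lt0n //; lia.
- by apply: bp_comm; lia.
- exact: bp_101.
- exact: bp_sq0.
- by apply: blob_sq; rewrite lt0n.
- by apply: blob_TL; rewrite ?lt0n //; lia.
- by apply: blob_comm; lia.
- exact: blob_101.
- exact: blob_sq0.
Qed.

Lemma nil_pi_lin : linear (pres_pi (@nil_blob_rel F n) : free_alg F n -> nil_blob_alg F n).
Proof. by move=> c x y; rewrite pres_piD -pres_piZ. Qed.

Lemma nil_pi_mul : {morph (pres_pi (@nil_blob_rel F n) : free_alg F n -> nil_blob_alg F n) : x y / x * y}.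
Proof. by move=> x y; rewrite -pres_piM. Qed.

Lemma blob_pi_lin q m : linear (pres_pi (@blob_rel F n q m) : free_alg F n -> blob_alg n q m).
Proof. by move=> c x y; rewrite pres_piD -pres_piZ. Qed.

Lemma blob_pi_mul q m : {morph (pres_pi (@blob_rel F n q m) : free_alg F n -> blob_alg n q m) : x y / x * y}.
Proof. by move=> x y; rewrite -pres_piM. Qed.
End Instances.
(** * The isomorphism *)

(** A map that takes 1 to the unit diagram and left multiplication by the generators
    to their action on diagrams is multiplicative, by induction on the first factor. *)
Lemma nil_intertwiner_mul (F : fieldType) (n : nat) (A : algType F)
    (pr : free_alg F n -> A) (sec : A -> free_alg F n) (f : {linear A -> nil_blob_diag F n}) :
  linear pr -> {morph pr : x y / x * y} -> pr 1 = 1 -> cancel sec pr ->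
  f 1 = diag_basis F (line_diag n) ->
  (forall i a, f (pr (free_gen F i) * a) = diag_act (- 2%:R) 0 0 i (f a)) ->
  {morph f : x y / x * y >-> diag_mul x y}.
Proof.
move=> pr_lin pr_mul pr1 secK f1 fM a b; rewrite -(secK a).
elim/free_ind: (sec a) => [|c x y IHx IHy|i x IH].
- by rewrite pr1 mul1r f1 diag_mul_line.
- by rewrite pr_lin mulrDl -scalerAl !linearP IHx IHy diag_mul_linearl.
- by rewrite pr_mul -mulrA !fM IH diag_mul_act.
Qed.

Lemma diag_act_line0 (F : fieldType) (delta gamma beta : F) n (i : 'I_n) : i = 0%N :> nat ->
  diag_act delta gamma beta i (diag_basis F (line_diag n)) = diag_basis F (marked_line_diag n).
Proof.
move=> i0; apply: etrans (diag_act_basis delta gamma beta i _) _.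
have -> : blob_act i (line_diag n) = marked_line_diag n.
  apply: val_inj; rewrite /= /gen i0 eqxx; congr pair; apply/setP => x.
  by rewrite !inE /= ffunE; case: x => j; rewrite ?(inj_eq inl_inj) ?(inj_eq inr_inj) -val_eqE /= i0 ?orbF.
by rewrite /gen_weight i0 eqxx /dot_weight inE; exact: scale1r.
Qed.

Lemma diag_act_line_cup (F : fieldType) (delta gamma beta : F) n (i : 'I_n) (i0 : (0 < i)%N) :
  diag_act delta gamma beta i (diag_basis F (line_diag n)) = diag_basis F (cup_diag i0).
Proof.
apply: etrans (diag_act_basis delta gamma beta i _) _.
have iN0 : i != 0%N :> nat by rewrite -lt0n.
have -> : blob_act i (line_diag n) = cup_diag i0.
  apply: val_inj; rewrite /= /gen (negbTE iN0) /=; congr pair; last first.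
    by apply/setP => x; rewrite !inE /= !ffunE; do 4?case: eqP.
  apply/ffunP => x; rewrite !ffunE.
  have := ord_pred_neq iN0; rewrite (inj_eq inl_inj).
  move: (ord_pred i) => p /negbTE pi.
  case: x => j; rewrite ?(inj_eq inl_inj) ?(inj_eq inr_inj) //=.
    by have [->|_] := eqVneq j p; [rewrite pi | case: ifP].
  by have [->|_] := eqVneq j p; [rewrite pi | case: ifP].
have -> : gen_weight delta gamma beta i (val (line_diag n)) = 1.
  by rewrite /gen_weight (negbTE iN0) /join_weight /= !ffunE inE.
exact: scale1r.
Qed.

Lemma presented_gen (F : fieldType) (delta gamma beta : F) n (A : algType F)
    (pr : free_alg F n -> A) (f : {linear A -> nil_blob_diag F n}) v :
  f 1 = v -> (forall i a, f (pr (free_gen F i) * a) = diag_act delta gamma beta i (f a)) ->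
  forall i, f (pr (free_gen F i)) = diag_act delta gamma beta i v.
Proof. by move=> <- fM i; rewrite -fM mulr1. Qed.

Theorem theorem2p5 (F : fieldType) (n : nat)
    (charF : 2%N \notin [pchar F]) (n_ge1 : (1 <= n)%N) :
  (exists f : {linear nil_blob_alg F n -> nil_blob_diag F n},
     [/\ bijective f,
         f 1 = diag_basis F (line_diag n),
         {morph f : x y / x * y >-> diag_mul x y},
         forall i : 'I_n, i = 0%N :> nat ->
           f (nil_blob_gen F i) = diag_basis F (marked_line_diag n) &
         forall (i : 'I_n) (i_gt0 : (0 < i)%N),
           f (nil_blob_gen F i) = diag_basis F (cup_diag i_gt0)]) /\
  has_dim (nil_blob_alg F n) 'C(2 * n, n) /\
  (forall (q : F) (m : int), q != 0 -> qint q m != 0 ->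
     has_dim (blob_alg n q m) 'C(2 * n, n)).
Proof.
have [f [[bij f1 fM] card]] := presented_iso (@free_ind F n) (@free_act_linear F (- 2%:R) 0 0 n)
  (@free_act1 F (- 2%:R) 0 0 n) (@free_actM F (- 2%:R) 0 0 n)
  (@nil_pi_lin F n) (@nil_pi_mul F n) erefl (@pres_reprK F n _)
  (@pres_pi_rel F _ _ _ n _ (@nil_blob_relE F n)) (@pres_pi_ker F _ _ _ n _ (@nil_blob_relE F n)).
split; last split.
- have fgen := presented_gen f1 fM.
  exists f; split; [exact: bij | exact: f1 | | |].
  + exact: (nil_intertwiner_mul (@nil_pi_lin F n) (@nil_pi_mul F n) erefl (@pres_reprK F n _) f1 fM).
  + by move=> i i0; apply: etrans (fgen i) _; apply: diag_act_line0.
  + by move=> i i0; apply: etrans (fgen i) _; apply: diag_act_line_cup.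
- exact: bij_has_dim bij card.
move=> q m _ _.
have [h [[hbij _ _] _]] := presented_iso (@free_ind F n) (@free_act_linear F (- qint q 2) (qint q (m - 1)) (- qint q m) n)
  (@free_act1 F _ _ _ n) (@free_actM F _ _ _ n)
  (@blob_pi_lin F n q m) (@blob_pi_mul F n q m) erefl (@pres_reprK F n _)
  (@pres_pi_rel F _ _ _ n _ (@blob_relE F n q m)) (@pres_pi_ker F _ _ _ n _ (@blob_relE F n q m)).
exact: bij_has_dim hbij card.
Qed.
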